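(* Let $\mathcal H$ be a complex separable Hilbert space, $\Sigma$ a Hausdorff, locally compact, $\sigma$-compact space endowed with a fixed Radon measure $\mu$, and $\pi:\Sigma\to\mathbb B(\mathcal H)$ a map such that: (a) $\int_\Sigma |\langle\pi(s)u,v\rangle|^2\,d\mu(s)=\|u\|^2\|v\|^2$ for all $u,v\in\mathcal H$; (b) $s\mapsto\pi(s)^*$ is strongly continuous; (c) the isometry $\Phi^\pi:\mathcal H\widehat\otimes\overline{\mathcal H}\to L^2(\Sigma)$ determined by $[\Phi^\pi(u\otimes v)](s)=\langle \pi(s)u,v\rangle$ is surjective. Let $\Omega$ be a bounded subset of $\mathcal H$. Consider the following assertions: 1. $\Omega$ is relatively compact. 2. For every $w\in\mathcal H$ the family $\phi^\pi_w(\Omega)$ is $\mathcal K(\Sigma)$-tight in $L^2(\Sigma)$. 3. There exists $w_0\in\mathcal H\setminus\{0\}$ such that the family $\phi^\pi_{w_0}(\Omega)$ is $\mathcal K(\Sigma)$-tight in $L^2(\Sigma)$. 4. For each $\epsilon>0$ there exists $f\in C_{\rm c}(\Sigma)$ with $\sup_{u\in\Omega}\|\Pi(f)u-u\|\le\epsilon$ (i.e. $\Omega$ is $\Pi[C_{\rm c}(\Sigma)]$-tight). 5. $\lim_{s\to s_0}\sup_{u\in\Omega}\|\pi(s)^*u-\pi(s_0)^*u\|=0$ for every $s_0\in\Sigma$. 6. For every $\epsilon>0$ and $s_0\in\Sigma$ there exists $g\in C_{\rm c}(\Sigma)$ such that $\sup_{u\in\Omega}\|\Pi(g)u-\pi(s_0)^*u\|\le\epsilon$.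 Then 1, 2, 3 and 4 are equivalent, they imply 5, which in its turn implies 6. Thus, if one assumes that $\pi(s_1)^*=1$ for some $s_1\in\Sigma$, then all six assertions are equivalent.
   Context: Inner products are linear in the first variable. $\mathbb B(\mathcal H)$ is the algebra of bounded operators on $\mathcal H$, $\overline{\mathcal H}$ is the conjugate Hilbert space of $\mathcal H$, $\widehat\otimes$ is the Hilbert space tensor product, $L^2(\Sigma)=L^2(\Sigma;\mu)$, and $C_{\rm c}(\Sigma)$ is the space of continuous compactly supported complex functions on $\Sigma$. For $w\in\mathcal H$, $\phi^\pi_w:\mathcal H\to L^2(\Sigma)$ is defined by $[\phi^\pi_w(u)](s):=\langle\pi(s)u,w\rangle$. Symbolic calculus: $\Pi:=\Lambda\circ(\Phi^\pi)^{-1}:L^2(\Sigma)\to\mathbb B_2(\mathcal H)$ (Hilbert-Schmidt operators), where $\Lambda:\mathcal H\widehat\otimes\overline{\mathcal H}\to\mathbb B_2(\mathcal H)$ is the unitary map determined by $\Lambda(u\otimes v)=\langle\cdot,v\rangle u$. Equivalently, in the weak sense, $\Pi(f)=\int_\Sigma f(s)\pi(s)^*\,d\mu(s)$. $\mathcal K(\Sigma)$ is the family of characteristic functions $\chi_L$ of compact subsets $L\subset\Sigma$, acting on $L^2(\Sigma)$ by multiplication. A bounded set $\Gamma\subset L^2(\Sigma)$ is $\mathcal K(\Sigma)$-tight if for every $\epsilon>0$ there is a compact $L\subset\Sigma$ with $\sup_{h\in\Gamma}\|\chi_Lh-h\|_{L^2(\Sigma)}\le\epsilon$.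
   Formalization: H is assumed nonzero (for H = {0}, 1 holds but 3 fails), and for 5 ⇒ 6 and the final equivalence of all six, μ is assumed positive on nonempty open sets (an added isolated μ-null point s1 with π(s1) = 1 is a counterexample otherwise). *)

(* Defs.v *)
From HB Require Import structures.
From mathcomp Require Import all_boot all_order all_algebra.
From mathcomp Require Import complex.
From mathcomp Require Import all_classical all_reals all_analysis.

Set Implicit Arguments.
Unset Strict Implicit.
Unset Printing Implicit Defensive.

Import Order.TTheory GRing.Theory Num.Theory.
Import numFieldNormedType.Exports.

Local Open Scope classical_set_scope.
Local Open Scope ring_scope.

(* Norms on spaces over R[i] take their values in R[i]; [rnorm] is the same
   norm with values in R. *)
Definition rnorm {R : realType} {V : normedZmodType R[i]} (x : V) : R :=
  complex.Re `|x|.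

(* Supremum of a family of nonnegative quantities, equal to 0 when A is
   empty (and not to -oo). *)
Definition sup_over {U : Type} {R : realType} (A : set U) (F : U -> \bar R)
    : \bar R :=
  ereal_sup (0%E |` F @` A).

(* The inner product is linear in its first argument. *)
HB.mixin Record CompleteNormedModule_isHilbert (R : realType) H
    & CompleteNormedModule R[i] H := {
  inner : H -> H -> R[i];
  inner_linearl : forall (a : R[i]) (u v w : H),
    inner (a *: u + v) w = a * inner u w + inner v w;
  inner_conj : forall u v : H, inner v u = (inner u v)^*;
  inner_norm : forall u : H, inner u u = `|u| ^+ 2
}.

#[short(type="hilbertType")]
HB.structure Definition Hilbert (R : realType) :=
  {H of CompleteNormedModule R[i] H & CompleteNormedModule_isHilbert R H}.

(* The conjugate Hilbert space: same additive group and norm, scalars act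
   through their conjugate and the inner product is flipped. *)
Definition conj_space {R : realType} (H : hilbertType R) : Type := H.

Section conj_space.
Variables (R : realType) (H : hilbertType R).
Local Notation Hc := (conj_space H).

HB.instance Definition _ := PseudoMetricNormedZmod.copy Hc H.
HB.instance Definition _ := Complete.copy Hc H.

Definition conj_scale (a : R[i]) (u : Hc) : Hc := a^* *: (u : H).

Fact conj_scaleA a b u : conj_scale a (conj_scale b u) = conj_scale (a * b) u.
Proof. by rewrite /conj_scale scalerA rmorphM. Qed.

Fact conj_scale1 : left_id 1 conj_scale.
Proof. by move=> u; rewrite /conj_scale conjC1 scale1r. Qed.

Fact conj_scaleDr : right_distributive conj_scale +%R.
Proof. by move=> a u v; exact: (scalerDr (a^*) (u : H) (v : H)). Qed.

Fact conj_scaleDl u : {morph conj_scale^~ u : a b / a + b}.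
Proof. by move=> a b; rewrite /conj_scale rmorphD; exact: scalerDl. Qed.

HB.instance Definition _ := GRing.Zmodule_isLmodule.Build R[i] Hc
  conj_scaleA conj_scale1 conj_scaleDr conj_scaleDl.

Fact conj_normrZ (a : R[i]) (u : Hc) : `|a *: u| = `|a| * `|u|.
Proof.
rewrite -(norm_conjC a); exact: (normrZ (a^*) (u : H)).
Qed.

HB.instance Definition _ :=
  PseudoMetricNormedZmod_Lmodule_isNormedModule.Build R[i] Hc conj_normrZ.

Definition conj_inner (u v : Hc) : R[i] := inner (v : H) (u : H).

Fact conj_inner_linearl (a : R[i]) (u v w : Hc) :
  conj_inner (a *: u + v) w = a * conj_inner u w + conj_inner v w.
Proof.
rewrite /conj_inner inner_conj.
have -> : inner (a *: u + v : H) (w : H)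
    = a^* * inner (u : H) (w : H) + inner (v : H) (w : H).
  exact: (@inner_linearl R H (a^*) u v w).
by rewrite rmorphD rmorphM /= conjCK -!inner_conj.
Qed.

Fact conj_inner_conj (u v : Hc) : conj_inner v u = (conj_inner u v)^*.
Proof. exact: inner_conj. Qed.

Fact conj_inner_norm (u : Hc) : conj_inner u u = `|u| ^+ 2.
Proof. exact: (@inner_norm R H u). Qed.

HB.instance Definition _ := CompleteNormedModule_isHilbert.Build R Hc
  conj_inner_linearl conj_inner_conj conj_inner_norm.

End conj_space.

Section hilbert.
Context {R : realType}.

Definition separable (H : hilbertType R) :=
  exists2 D : set H, countable D & dense D.

Definition lin_span {H : hilbertType R} (E : set H) : set H :=
  [set x | exists s : seq (R[i] * H),
     (forall p, p \in s -> E p.2) /\ x = \sum_(p <- s) p.1 *: p.2].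

Definition orthonormal_basis {H : hilbertType R} (E : set H) :=
  (forall e f, E e -> E f -> inner e f = (e == f)%:R) /\
  closure (lin_span E) = setT.

(* The Hilbert space tensor product of H1 and H2, up to the unique unitary
   isomorphism compatible with the simple tensors. *)
Record hilbertTensor (H1 H2 : hilbertType R) := HilbertTensor {
  tensor_space :> hilbertType R;
  tens : H1 -> H2 -> tensor_space;
  tens_linearl : forall v, linear (tens^~ v);
  tens_linearr : forall u, linear (tens u);
  tens_inner : forall u u' v v',
    inner (tens u v) (tens u' v') = inner u u' * inner v v';
  tens_total : closure (lin_span [set t | exists u v, t = tens u v]) = setT
}.

(* Elements of B(H) are represented by their underlying functions; over a
   normed module, a linear map is bounded iff it is continuous. *)
Definition bounded_operator {H : hilbertType R} (A : H -> H) :=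
  linear A /\ continuous A.

(* The Hilbert space adjoint; the vector w below exists (Riesz) and is unique
   as soon as A is a bounded operator. *)
Definition adjoint {H : hilbertType R} (A : H -> H) (v : H) : H :=
  xget 0 [set w | forall u, inner (A u) v = inner u w].

(* Squared Hilbert-Schmidt norm; its value does not depend on the orthonormal
   basis E. *)
Definition hs_norm2 {H : hilbertType R} (E : set H) (A : H -> H) : \bar R :=
  (\esum_(e in E) (rnorm (A e) ^+ 2)%:E)%E.

Definition hilbert_schmidt {H : hilbertType R} (A : H -> H) :=
  bounded_operator A /\
  exists2 E, orthonormal_basis E & (hs_norm2 E A < +oo)%E.

(* Lambda is the unitary map from the tensor product of H and its conjugate
   onto the Hilbert-Schmidt operators sending u (x) v to <., v> u. *)
Definition is_Lambda {H : hilbertType R} (T : hilbertTensor H (conj_space H))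
    (Lambda : T -> H -> H) :=
  [/\ forall psi, hilbert_schmidt (Lambda psi),
      forall (a : R[i]) psi chi x,
        Lambda (a *: psi + chi) x = a *: Lambda psi x + Lambda chi x,
      forall psi E, orthonormal_basis E ->
        hs_norm2 E (Lambda psi) = (rnorm psi ^+ 2)%:E,
      forall A, hilbert_schmidt A -> exists psi, Lambda psi = A &
      forall u v x, Lambda (tens T u v) x = inner x v *: u].

End hilbert.

Section topology.
Context {R : realType}.

Definition sigma_compact (X : topologicalType) :=
  exists2 K : nat -> set X, forall n, compact (K n) & \bigcup_n K n = setT.

Definition Cc (X : topologicalType) : set (X -> R[i]) :=
  [set f | continuous (f : X -> R[i]^o) /\
           compact (closure [set s | f s != 0])].

End topology.

(* X with its Borel sigma-algebra. *)
Notation borel X := (g_sigma_algebraType (@open X)).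

Section measure_on_space.
Context {R : realType} {X : ptopologicalType}.
Variable mu : {measure set (borel X) -> \bar R}.

Definition radon :=
  [/\ forall K : set X, compact K -> (mu K < +oo)%E,
      forall A : set (borel X), measurable A ->
        mu A = ereal_inf [set mu U | U in [set U : set X | open U /\ A `<=` U]] &
      forall U : set X, open U ->
        mu U = ereal_sup [set mu K | K in [set K : set X | compact K /\ K `<=` U]]].

Definition full_support :=
  forall U : set X, open U -> U !=set0 -> (0 < mu U)%E.

(* L^2(X; mu) is represented by its square-integrable measurable functions;
   identification of functions equal almost everywhere is left explicit. *)
Definition L2norm (f : X -> R[i]) : \bar R :=
  Lnorm mu 2%:E (fun s => (rnorm (f s))%:E).

Definition L2 : set (X -> R[i]) :=
  [set f | [/\ measurable_fun setT ((fun s => complex.Re (f s)) : borel X -> R),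
               measurable_fun setT ((fun s => complex.Im (f s)) : borel X -> R) &
               (L2norm f < +oo)%E]].

Definition ae_equal (f g : X -> R[i]) := {ae mu, forall s : borel X, f s = g s}.

Definition L2_bounded (G : set (X -> R[i])) :=
  G `<=` L2 /\ exists M : R, forall h, G h -> (L2norm h <= M%:E)%E.

Definition K_tight (G : set (X -> R[i])) :=
  L2_bounded G /\
  forall eps : R, 0 < eps -> exists2 L : set X, compact L &
    (sup_over G (fun h => L2norm (fun s => \1_L s * h s - h s)%R) <= eps%:E)%E.

Context {H : hilbertType R}.
Variable pi_ : X -> H -> H.

Definition phi (w u : H) : X -> R[i] := fun s => inner (pi_ s u) w.

(* Phi is the linear isometry from the tensor product of H and its conjugate
   into L^2(X; mu) sending u (x) v to s |-> <pi(s) u, v>; these conditions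
   determine Phi psi almost everywhere, for every psi. *)
Definition is_Phi (T : hilbertTensor H (conj_space H)) (Phi : T -> X -> R[i]) :=
  [/\ forall psi, L2 (Phi psi),
      forall (a : R[i]) psi chi,
        ae_equal (Phi (a *: psi + chi)) (fun s => a * Phi psi s + Phi chi s),
      forall psi, L2norm (Phi psi) = (rnorm psi)%:E &
      forall u v, ae_equal (Phi (tens T u v)) (fun s => inner (pi_ s u) v)].

Definition L2_surjective (T : hilbertTensor H (conj_space H))
    (Phi : T -> X -> R[i]) :=
  forall f, L2 f -> exists psi, ae_equal (Phi psi) f.

(* Pi = Lambda o Phi^-1. *)
Definition Pi_calculus (T : hilbertTensor H (conj_space H))
    (Phi : T -> X -> R[i]) (Lambda : T -> H -> H) (f : X -> R[i]) : H -> H :=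
  Lambda (xget 0 [set psi | ae_equal (Phi psi) f]).

End measure_on_space.

(* Main.v *)
Require Import Defs.
From mathcomp Require Import all_boot all_order all_algebra.
From mathcomp Require Import complex finmap ring lra.
From mathcomp Require Import all_classical all_reals all_analysis.
From mathcomp Require Import measurable_realfun.

(** The first four assertions say in different ways that Omega is totally bounded,
    which, H being complete, means that it is relatively compact.

    Compactness is obtained from partitions: a set has compact closure as soon as
    it splits, for every e > 0, into finitely many pieces of diameter at most e
    ([split_compact_closure]), and finitely many bounded scalar functions split
    any set into finitely many pieces on which they are all nearly constant
    ([bounded_complex_finitely_split]).  So it suffices to control |u - v|, for
    u and v in Omega, by finitely many scalar products and a small error.

    Tightness of phi_w(Omega) for one nonzero w gives such a control
    ([K_tight_compact]).  By the orthogonality relation |u - v| |w| is the L^2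
    norm of s |-> <u - v, pi(s)^* w>.  Outside a compact set L this function is
    negligible; on L, which has finite measure, it is governed by finitely many
    scalar products because pi(s)^* w runs over a compact set.  Conversely, the
    tail of one square-integrable function vanishes along an exhaustion of Sigma
    by compact sets, and a finite net of Omega makes this uniform
    ([compact_K_tight]).

    For the symbolic calculus, the key identity is
    <Lambda psi x, y> = <psi, y (x) x> ([Lambda_inner]).  It bounds the operator
    norm of Lambda psi by |psi|, so that Lambda psi is a norm limit of operators of
    finite rank and maps Omega to a totally bounded set; if Pi f nearly fixes
    Omega, then Omega is totally bounded as well ([Pi_tight_compact]).
    Conversely, when Omega is relatively compact, the orthogonal projection onto
    the span of finitely many vectors v of an orthonormal basis nearly fixes
    Omega.  Its symbol is the continuous square-integrable function
    s |-> sum of <pi(s) v, v>, and cutting it off by a bump function gives a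
    symbol with compact support ([compact_Pi_tight]).

    Relative compactness gives equicontinuity of s |-> pi(s)^* on Omega because the
    operators pi(s)^* are uniformly bounded near each point, by the uniform
    boundedness principle on a compact neighbourhood ([compact_equicontinuous]).
    Given equicontinuity at s0, averaging pi(s)^* against a nonnegative g of
    integral 1 concentrated near s0 produces a Pi g that is close to pi(s0)^* on
    Omega ([equicontinuous_Pi_approx]); such g exist when mu charges every
    nonempty open set.  Finally, when pi(s1)^* is the identity, this approximation
    at s1 is tightness for the symbolic calculus. *)

Import Order.TTheory GRing.Theory Num.Theory.
Import numFieldNormedType.Exports.

Local Open Scope classical_set_scope.
Local Open Scope ring_scope.

Set Implicit Arguments.
Unset Strict Implicit.
Unset Printing Implicit Defensive.

Local Notation Re := complex.Re.
Local Notation Im := complex.Im.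

(** * Complex numbers, real-valued norms and inner products *)

(** These identities concern the projections of [R[i]] to [R]; the leading c
    sets them apart from those on the complex-valued ['Re] and ['Im]. *)
Section complex_parts.
Context {R : realType}.
Implicit Types (z w : R[i]) (x : R).

Lemma cReD z w : Re (z + w) = Re z + Re w. Proof. by case: z; case: w. Qed.

Lemma cImD z w : Im (z + w) = Im z + Im w. Proof. by case: z; case: w. Qed.

Lemma cReN z : Re (- z) = - Re z. Proof. by case: z. Qed.

Lemma cImN z : Im (- z) = - Im z. Proof. by case: z. Qed.

Lemma cReM z w : Re (z * w) = Re z * Re w - Im z * Im w.
Proof. by case: z; case: w. Qed.

Lemma cImM z w : Im (z * w) = Re z * Im w + Im z * Re w.
Proof. by case: z; case: w. Qed.

Lemma cRe_conj z : Re (z^*) = Re z. Proof. by case: z. Qed.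

Lemma cReZ x z : Re (x%:C%C * z) = x * Re z.
Proof. by rewrite cReM /= mul0r subr0. Qed.

Lemma conj_real x : (x%:C%C : R[i])^* = x%:C%C.
Proof. exact: conjc_real. Qed.

Lemma real_complexD x y : (x + y)%:C%C = x%:C%C + y%:C%C :> R[i].
Proof. exact: rmorphD. Qed.

Lemma real_complexM x y : (x * y)%:C%C = x%:C%C * y%:C%C :> R[i].
Proof. exact: rmorphM. Qed.

Lemma real_complexXn x n : (x ^+ n)%:C%C = x%:C%C ^+ n :> R[i].
Proof. exact: rmorphXn. Qed.

End complex_parts.

Section rnorm.
Context {R : realType}.

Lemma rnormE (V : normedZmodType R[i]) (x : V) : `|x| = (rnorm x)%:C%C.
Proof. by rewrite RRe_real// ger0_real. Qed.

Lemma rnorm_ge0 (V : normedZmodType R[i]) (x : V) : 0 <= rnorm x.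
Proof. by rewrite -ler0c -rnormE. Qed.

Lemma ler_rnormD (V : normedZmodType R[i]) (x y : V) :
  rnorm (x + y) <= rnorm x + rnorm y.
Proof. by rewrite -lecR real_complexD -!rnormE ler_normD. Qed.

Lemma rnormN (V : normedZmodType R[i]) (x : V) : rnorm (- x) = rnorm x.
Proof. by rewrite /rnorm normrN. Qed.

Lemma rnorm_distC (V : normedZmodType R[i]) (x y : V) :
  rnorm (x - y) = rnorm (y - x).
Proof. by rewrite /rnorm distrC. Qed.

Lemma ler_rdistD (V : normedZmodType R[i]) (z x y : V) :
  rnorm (x - y) <= rnorm (x - z) + rnorm (z - y).
Proof. by apply: le_trans (ler_rnormD _ _); rewrite addrA subrK. Qed.

Lemma ler_rnormB (V : normedZmodType R[i]) (x y : V) :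
  rnorm (x - y) <= rnorm x + rnorm y.
Proof. by rewrite -(rnormN y) ler_rnormD. Qed.

Lemma rnorm0 (V : normedZmodType R[i]) : rnorm (0 : V) = 0.
Proof. by rewrite /rnorm normr0. Qed.

Lemma rnorm_eq0 (V : normedZmodType R[i]) (x : V) : (rnorm x == 0) = (x == 0).
Proof. by rewrite -(normr_eq0 x) rnormE eq_complex /= eqxx andbT. Qed.

Lemma rnorm_gt0 (V : normedZmodType R[i]) (x : V) : (0 < rnorm x) = (x != 0).
Proof. by rewrite lt_def rnorm_eq0 rnorm_ge0 andbT. Qed.

Lemma rnormZ (V : normedModType R[i]) a (x : V) :
  rnorm (a *: x) = rnorm a * rnorm x.
Proof. by rewrite {1}/rnorm normrZ !rnormE -real_complexM. Qed.

Lemma rnormM (a b : R[i]) : rnorm (a * b) = rnorm a * rnorm b.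
Proof. by rewrite {1}/rnorm normrM !rnormE -real_complexM. Qed.

Lemma rnorm_real (x : R) : rnorm (x%:C%C : R[i]) = `|x|.
Proof. by rewrite /rnorm normc_def /= expr0n addr0 sqrtr_sqr. Qed.

Lemma rnorm_sqr (z : R[i]) : rnorm z ^+ 2 = Re z ^+ 2 + Im z ^+ 2.
Proof.
by rewrite /rnorm normc_def /= sqr_sqrtr// addr_ge0// sqr_ge0.
Qed.

Lemma ler_Re_rnorm (z : R[i]) : `|Re z| <= rnorm z.
Proof.
rewrite -(@ler_pXn2r _ 2)// ?nnegrE ?rnorm_ge0//.
by rewrite rnorm_sqr real_normK ?num_real// lerDl sqr_ge0.
Qed.

Lemma ler_Im_rnorm (z : R[i]) : `|Im z| <= rnorm z.
Proof.
rewrite -(@ler_pXn2r _ 2)// ?nnegrE ?rnorm_ge0//.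
by rewrite rnorm_sqr real_normK ?num_real// lerDr sqr_ge0.
Qed.

Lemma rnorm_le_ReIm (z : R[i]) : rnorm z <= `|Re z| + `|Im z|.
Proof.
rewrite -(@ler_pXn2r _ 2)// ?nnegrE ?rnorm_ge0 ?addr_ge0//.
rewrite rnorm_sqr sqrrD !real_normK ?num_real//.
by rewrite addrAC lerDl mulrn_wge0// mulr_ge0.
Qed.

Lemma ler_rnorm_sum (V : normedZmodType R[i]) I (s : seq I) (F : I -> V) :
  rnorm (\sum_(i <- s) F i) <= \sum_(i <- s) rnorm (F i).
Proof.
elim/big_rec2 : _ => [|i y x _ xy]; first by rewrite rnorm0.
by rewrite (le_trans (ler_rnormD _ _))// lerD2l.
Qed.

End rnorm.

Section rnorm_topology.
Context {R : realType}.

Lemma gt0_complex (e : R[i]) : 0 < e -> e = (Re e)%:C%C /\ 0 < Re e.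
Proof.
move=> e0; have -> : (Re e)%:C%C = e by rewrite RRe_real// gtr0_real.
by split=> //; move: e0; rewrite ltcE => /andP[].
Qed.

Lemma ball_rnorm (V : pseudoMetricNormedZmodType R[i]) (x y : V) (e : R) :
  ball x e%:C%C y = (rnorm (x - y) < e) :> Prop.
Proof. by rewrite -ball_normE/= rnormE ltcR. Qed.

Lemma nbhs_rnorm (V : pseudoMetricNormedZmodType R[i]) (x : V) (A : set V) :
  nbhs x A <-> exists2 e : R, 0 < e & forall y, rnorm (x - y) < e -> A y.
Proof.
rewrite nbhs_ballP; split=> [[e /= /gt0_complex[-> e0] eA]|[e e0 eA]].
  by exists (Re e) => // y xy; apply: eA; rewrite ball_rnorm.
by exists e%:C%C => [/=|y]; rewrite ?ltcR// ball_rnorm => /eA.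
Qed.

Lemma cvg_rnormP (V : pseudoMetricNormedZmodType R[i]) T (F : set_system T)
    {FF : Filter F} (f : T -> V) (y : V) :
  f @ F --> y <->
  forall e : R, 0 < e -> \forall t \near F, rnorm (y - f t) < e.
Proof.
split=> [fy e e0|fy A /nbhs_rnorm[e e0 eA]].
  by apply: (fy [set z | rnorm (y - z) < e]); apply/nbhs_rnorm; exists e.
by apply: filterS (fy _ e0) => t /eA.
Qed.

Lemma closure_rnorm (V : pseudoMetricNormedZmodType R[i]) (A : set V) x :
  closure A x <-> forall e : R, 0 < e -> exists2 y, A y & rnorm (x - y) < e.
Proof.
split=> [clA e e0|H B /nbhs_rnorm[e e0 eB]].
  have /clA[y [Ay xy]] : nbhs x [set y | rnorm (x - y) < e].
    by apply/nbhs_rnorm; exists e.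
  by exists y.
by have [y Ay /eB By] := H _ e0; exists y.
Qed.

Lemma bounded_rnorm (V : normedModType R[i]) (A : set V) :
  bounded_set A -> exists2 M : R, 0 < M & forall x, A x -> rnorm x <= M.
Proof.
move=> [N [Nreal NA]].
exists (Num.max (Re N) 0 + 1) => [|x Ax].
  by rewrite ltr_wpDl// le_max lexx orbT.
have /NA/(_ x Ax) : N < (Num.max (Re N) 0 + 1)%:C%C.
  by rewrite -(RRe_real Nreal) ltcR ltr_pwDr// le_max lexx.
by rewrite /= rnormE lecR.
Qed.

End rnorm_topology.

Section inner_product.
Context {R : realType} {H : hilbertType R}.
Implicit Types (u v w : H) (a : R[i]).

Lemma innerDl u v w : inner (u + v) w = inner u w + inner v w.
Proof. by rewrite -[u]scale1r inner_linearl mul1r scale1r. Qed.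

Lemma inner0l w : inner 0 w = 0 :> R[i].
Proof. by apply: (addrI (inner 0 w)); rewrite -innerDl !addr0. Qed.

Lemma innerZl a u w : inner (a *: u) w = a * inner u w.
Proof. by rewrite -[a *: u]addr0 inner_linearl inner0l addr0. Qed.

Lemma innerNl u w : inner (- u) w = - inner u w.
Proof. by rewrite -scaleN1r innerZl mulN1r. Qed.

Lemma innerBl u v w : inner (u - v) w = inner u w - inner v w.
Proof. by rewrite innerDl innerNl. Qed.

Lemma innerDr u v w : inner w (u + v) = inner w u + inner w v.
Proof. by rewrite inner_conj innerDl rmorphD /= -!inner_conj. Qed.

Lemma inner0r w : inner w 0 = 0 :> R[i].
Proof. by rewrite inner_conj inner0l rmorph0. Qed.

Lemma innerZr a u w : inner w (a *: u) = a^* * inner w u.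
Proof. by rewrite inner_conj innerZl rmorphM /= -!inner_conj. Qed.

Lemma innerNr u w : inner w (- u) = - inner w u.
Proof. by rewrite inner_conj innerNl rmorphN /= -!inner_conj. Qed.

Lemma innerBr u v w : inner w (u - v) = inner w u - inner w v.
Proof. by rewrite innerDr innerNr. Qed.

Lemma inner_suml I (s : seq I) (F : I -> H) w :
  inner (\sum_(i <- s) F i) w = \sum_(i <- s) inner (F i) w.
Proof.
elim: s => [|i s IHs]; first by rewrite !big_nil inner0l.
by rewrite !big_cons innerDl IHs.
Qed.

Lemma inner_sumr I (s : seq I) (F : I -> H) w :
  inner w (\sum_(i <- s) F i) = \sum_(i <- s) inner w (F i).
Proof.
elim: s => [|i s IHs]; first by rewrite !big_nil inner0r.
by rewrite !big_cons innerDr IHs.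
Qed.

Lemma Re_innerC u v : Re (inner u v) = Re (inner v u).
Proof. by rewrite inner_conj cRe_conj. Qed.

Lemma innerxx u : inner u u = (rnorm u ^+ 2)%:C%C.
Proof. by rewrite inner_norm rnormE real_complexXn. Qed.

Lemma Re_innerxx u : Re (inner u u) = rnorm u ^+ 2.
Proof. by rewrite innerxx. Qed.

Lemma rnorm_sqrD u v :
  rnorm (u + v) ^+ 2 = rnorm u ^+ 2 + rnorm v ^+ 2 + 2 * Re (inner u v).
Proof.
rewrite -!Re_innerxx innerDl !innerDr !cReD (Re_innerC v u).
by ring.
Qed.

Lemma rnorm_sqrB u v :
  rnorm (u - v) ^+ 2 = rnorm u ^+ 2 + rnorm v ^+ 2 - 2 * Re (inner u v).
Proof. by rewrite rnorm_sqrD rnormN innerNr cReN mulrN. Qed.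

(** Expand the squared norm of |v| u - |u| v, which is nonnegative. *)
Lemma Re_inner_le u v : Re (inner u v) <= rnorm u * rnorm v.
Proof.
have [->|u0] := eqVneq u 0; first by rewrite inner0l rnorm0 mul0r.
have [->|v0] := eqVneq v 0; first by rewrite inner0r rnorm0 mulr0.
have := sqr_ge0 (rnorm ((rnorm v)%:C%C *: u - (rnorm u)%:C%C *: v)).
rewrite rnorm_sqrB !rnormZ innerZl innerZr conj_real !cReZ !rnorm_real.
rewrite !ger0_norm ?rnorm_ge0//.
move: u0 v0; rewrite -!rnorm_gt0.
move: (rnorm u) (rnorm v) (Re _) => a b c a0 b0.
have ab0 : 0 < a * b by rewrite mulr_gt0.
move=> H0; rewrite -subr_ge0 -(pmulr_rge0 _ ab0) -(pmulr_rge0 _ (ltr0Sn R 1)).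
by apply: le_trans H0 _; rewrite le_eqVlt; apply/orP; left; apply/eqP; ring.
Qed.

(** The bound on real parts gives the bound on moduli once v is multiplied by
    z = <u, v>, since then <u, z v> = |z|^2 is real. *)
Lemma cauchy_schwarz u v : rnorm (inner u v) <= rnorm u * rnorm v.
Proof.
have [->|z0] := eqVneq (inner u v) 0.
  by rewrite rnorm0 mulr_ge0 ?rnorm_ge0.
have := Re_inner_le u (inner u v *: v).
rewrite innerZr -rnorm_gt0 in z0 *.
rewrite mulrC -normCK rnormE -real_complexXn /= rnormZ.
by rewrite mulrCA expr2 ler_pM2l.
Qed.

Lemma inner_eq u v : (forall w, inner w u = inner w v) -> u = v.
Proof.
move=> uv; apply/eqP; rewrite -subr_eq0 -rnorm_eq0 -sqrf_eq0 -Re_innerxx.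
by rewrite innerBr uv subrr.
Qed.

End inner_product.

(** * Completeness, Riesz representation and adjoints *)
Section completeness.
Context {R : realType}.

Lemma cauchy_rnorm_cvg (V : completeNormedModType R[i]) (F : set_system V) :
    ProperFilter F ->
    (forall e : R, 0 < e -> exists x, F [set y | rnorm (x - y) < e]) ->
  exists l : V, F --> l.
Proof.
move=> FF Fe; suff /cauchy_cvgP Fl : cauchy F by exists (lim F).
apply: cauchy_exP => e /gt0_complex[-> e0]; have [x Fx] := Fe _ e0.
by exists x; apply: filterS Fx => y /=; rewrite -ball_rnorm.
Qed.

Lemma cauchy_seq_rnorm_cvg (V : completeNormedModType R[i]) (x_ : nat -> V) :
    (forall e : R, 0 < e ->
       exists N, forall n, (N <= n)%N -> rnorm (x_ N - x_ n) < e) ->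
  exists l : V, x_ @ \oo --> l.
Proof.
move=> xe; apply: cauchy_rnorm_cvg => e /xe[N xN]; exists (x_ N).
by exists N => // n /=; exact: xN.
Qed.

End completeness.

Section bounded_operators.
Context {R : realType}.

Section linear_maps.
Variables (V W : lmodType R[i]) (A : V -> W).
Hypothesis linA : linear A.

Lemma linear_fun0 : A 0 = 0.
Proof.
by have := linA (-1) 0 0; rewrite scaleN1r scaleN1r oppr0 add0r addNr.
Qed.

Lemma linear_funZ a x : A (a *: x) = a *: A x.
Proof. by have := linA a x 0; rewrite !addr0 linear_fun0 addr0. Qed.

Lemma linear_funD x y : A (x + y) = A x + A y.
Proof. by have := linA 1 x y; rewrite !scale1r. Qed.

Lemma linear_funB x y : A (x - y) = A x - A y.
Proof. by rewrite linear_funD -scaleN1r linear_funZ scaleN1r. Qed.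

End linear_maps.

(** The factor 2 comes from rescaling x to norm r / 2, strictly inside the
    ball where A is controlled. *)
Lemma linear_boundedP (V W : normedModType R[i]) (A : V -> W) (r C : R) :
    linear A -> 0 < r -> (forall x, rnorm x < r -> rnorm (A x) <= C) ->
  forall x, rnorm (A x) <= C * 2 / r * rnorm x.
Proof.
move=> linA r0 AC x; have [->|] := eqVneq x 0.
  by rewrite (linear_fun0 linA) !rnorm0 mulr0.
rewrite -rnorm_gt0 => x0; set t := r / 2 / rnorm x.
have t0 : 0 < t by rewrite !divr_gt0.
have := AC (t%:C%C *: x).
rewrite linear_funZ// !rnormZ rnorm_real gtr0_norm//.
rewrite divfK ?gt_eqF// gtr_pMr// invf_lt1// ltr1n => /(_ isT).
rewrite mulrC -ler_pdivlMr//; congr (_ <= _).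
by rewrite /t; field; rewrite !gt_eqF.
Qed.

Lemma continuous_linear_rnorm (V W : normedModType R[i]) (A : V -> W) :
    linear A -> {for 0, continuous A} ->
  exists2 M : R, 0 < M & forall x, rnorm (A x) <= M * rnorm x.
Proof.
move=> linA /cvg_rnormP/(_ 1 ltr01)/nbhs_rnorm[d d0 Ad].
exists (1 * 2 / d); first by rewrite mul1r divr_gt0.
apply: linear_boundedP => // x xd.
by have := Ad x; rewrite (linear_fun0 linA) !sub0r !rnormN => /(_ xd)/ltW.
Qed.

Lemma bounded_operator_rnorm (H : hilbertType R) (A : H -> H) :
    bounded_operator A ->
  exists2 M : R, 0 < M & forall x, rnorm (A x) <= M * rnorm x.
Proof.
by move=> [linA contA]; apply: continuous_linear_rnorm => //; exact: contA.
Qed.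

End bounded_operators.

Section riesz.
Context {R : realType} {H : hilbertType R}.

(** The representing vector is the minimiser of J x = |x|^2 - 2 Re (f x).  By
    the parallelogram identity a minimising sequence is Cauchy, and at its limit
    l the first-order condition in the direction y reads
    Re (f y) = Re <y, l>; imaginary parts follow by replacing y with -i y. *)
Lemma riesz (f : H -> R[i]) (M : R) :
    (forall a u v, f (a *: u + v) = a * f u + f v) ->
    (forall u, rnorm (f u) <= M * rnorm u) ->
  exists w, forall u, f u = inner u w.
Proof.
move=> linf fM.
have fD u v : f (u + v) = f u + f v by rewrite -[u]scale1r linf mul1r scale1r.
have f0 : f 0 = 0 by apply: (addrI (f 0)); rewrite -fD !addr0.
have fZ a u : f (a *: u) = a * f u by rewrite -[_ *: _]addr0 linf f0 addr0.
pose J (x : H) : R := rnorm x ^+ 2 - 2 * Re (f x).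
have J_lb x : - M ^+ 2 <= J x.
  have := fM x; have := le_trans (ler_norm _) (ler_Re_rnorm (f x)).
  rewrite /J; move: (Re _) (rnorm (f x)) (rnorm x) => a b c ab bMc.
  by have := sqr_ge0 (c - M); nra.
pose m := inf (range J).
have hasJ : has_inf (range J).
  split; first by exists (J 0), 0.
  by exists (- M ^+ 2) => _ [x _ <-]; exact: J_lb.
have mJ x : m <= J x by have := ge_inf (proj2 hasJ); apply; exists x.
have J_parallelogram x y :
    rnorm (x - y) ^+ 2 <= 2 * (J x - m) + 2 * (J y - m).
  have := mJ (2^-1%:C%C *: (x + y)); rewrite rnorm_sqrB /J fZ fD cReZ cReD.
  rewrite rnormZ exprMn rnorm_real ger0_norm ?invr_ge0// rnorm_sqrD.
  move: (rnorm x ^+ 2) (rnorm y ^+ 2) (Re (f x)) (Re (f y)) (Re _) => a b c d e.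
  by rewrite exprVn; lra.
have /choice[x_ x_m] : forall n, exists x, J x < m + n.+1%:R^-1.
  move=> n; have n0 : 0 < n.+1%:R^-1 :> R by rewrite invr_gt0.
  by have [_ [x _ <-] Jx] := inf_adherent n0 hasJ; exists x.
have [l x_l] : exists l : H, x_ @ \oo --> l.
  apply: cauchy_seq_rnorm_cvg => e e0.
  have e20 : 0 < e ^+ 2 / 4 by rewrite divr_gt0// exprn_gt0.
  have [N Ne] : exists N, N.+1%:R^-1 < e ^+ 2 / 4.
    exists (Num.truncn (e ^+ 2 / 4)^-1).
    by rewrite -ltf_pV2 ?posrE ?invr_gt0// invrK truncnS_gt.
  exists N => n Nn; rewrite -(@ltr_pXn2r _ 2)// ?nnegrE ?rnorm_ge0 ?ltW//.
  apply: le_lt_trans (J_parallelogram _ _) _.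
  have : n.+1%:R^-1 <= N.+1%:R^-1 :> R by rewrite lef_pV2 ?posrE ?ler_nat.
  have := x_m n; have := x_m N; move: Ne.
  move: (N.+1%:R^-1) (n.+1%:R^-1) (J _) (J _) (e ^+ 2) => a b c d g.
  lra.
(* Obtained from J (x_ n + t y) >= m by letting n tend to infinity, which avoids
   the continuity of J. *)
have first_order y (t : R) :
    0 <= 2 * t * (Re (inner l y) - Re (f y)) + t ^+ 2 * rnorm y ^+ 2.
  apply/ler_addgt0Pr => e e0.
  have e20 : 0 < e / 2 by rewrite divr_gt0.
  pose k := `|t| * rnorm y.
  have k0 : 0 <= k by rewrite mulr_ge0 ?rnorm_ge0.
  near \oo => n.
  have := mJ (x_ n + t%:C%C *: y); have := x_m n.
  have : n.+1%:R^-1 < e / 2.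
    by near: n; exact: (near_infty_natSinv_lt (PosNum e20)).
  have : 2 * (t * (Re (inner (x_ n) y) - Re (inner l y))) <= e / 2.
    rewrite -cReN -innerNl -cReD -innerDl -cReZ -innerZl.
    rewrite -ler_pdivlMl// (le_trans (Re_inner_le _ _))// rnormZ rnorm_real.
    rewrite mulrAC rnorm_distC -/k.
    have : rnorm (l - x_ n) < 2^-1 * (e / 2) / (k + 1).
      near: n; move/cvg_rnormP: x_l; apply.
      by rewrite divr_gt0 ?mulr_gt0 ?invr_gt0 ?ltr_wpDl.
    rewrite ltr_pdivlMr ?ltr_wpDl// => /ltW; apply: le_trans.
    by rewrite mulrC ler_wpM2l ?rnorm_ge0// lerDl.
  rewrite /J rnorm_sqrD rnormZ exprMn rnorm_real fD fZ cReD cReZ.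
  rewrite innerZr conj_real cReZ real_normK ?num_real//.
  move: (rnorm y ^+ 2) (n.+1%:R^-1) (Re (f y)) (Re (inner l y)) => b c d g.
  move: (Re (inner _ y)) (Re (f _)) (rnorm _ ^+ 2) => h i j.
  by clear; move: (t ^+ 2 * b) (c : R) => u {}c; lra.
(* A function t |-> 2 t c + t^2 b can be nonnegative everywhere only if c = 0:
   test it at t = - c / (b + 1), where b + 1 avoids dividing by zero. *)
have Re_f y : Re (f y) = Re (inner y l).
  rewrite (Re_innerC y); apply/eqP; rewrite eq_sym -subr_eq0.
  set c := _ - _; set b := rnorm y ^+ 2.
  have b1 : 0 < b + 1 by rewrite ltr_wpDl ?sqr_ge0.
  have := first_order y (- c / (b + 1)); rewrite -/c -/b.
  have -> : 2 * (- c / (b + 1)) * c + (- c / (b + 1)) ^+ 2 * b =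
      - (c ^+ 2 * ((b + 2) / (b + 1) ^+ 2)) by field; rewrite gt_eqF.
  rewrite oppr_ge0 pmulr_lle0 ?divr_gt0 ?exprn_gt0//; last first.
    by rewrite ltr_wpDl ?sqr_ge0.
  by rewrite real_exprn_even_le0 ?num_real.
exists l => u; apply/eqP; rewrite eq_complex Re_f eqxx /=.
have := Re_f ((- 'i%C) *: u); rewrite fZ innerZl !mulNr !cReN.
by rewrite !(mulrC 'i%C) !ReiNIm !opprK => ->.
Unshelve. all: by end_near. Qed.

End riesz.

Section adjoints.
Context {R : realType} {H : hilbertType R}.
Variable A : H -> H.
Hypothesis bA : bounded_operator A.

(** The value of [adjoint] chosen by [xget] is a genuine one because, by Riesz
    representation, some vector represents u |-> <A u, v>. *)
Lemma adjointP u v : inner (A u) v = inner u (adjoint A v).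
Proof.
have [M M0 AM] := bounded_operator_rnorm bA.
have [w fw] : exists w, forall u, inner (A u) v = inner u w.
  apply: (@riesz _ _ _ (M * rnorm v)) => [a x y|x].
    by rewrite bA.1 inner_linearl.
  rewrite (le_trans (cauchy_schwarz _ _))// mulrAC.
  by rewrite ler_wpM2r ?rnorm_ge0.
by move: u; rewrite /adjoint; case: xgetP => [x _|/(_ w)].
Qed.

Lemma adjoint_linear : linear (adjoint A).
Proof.
move=> a u v; apply: inner_eq => w.
by rewrite innerDr innerZr -!adjointP innerDr innerZr.
Qed.

Lemma adjoint_bounded :
  exists2 M : R, 0 < M & forall v, rnorm (adjoint A v) <= M * rnorm v.
Proof.
have [M M0 AM] := bounded_operator_rnorm bA; exists M => // v.
have [->|] := eqVneq (adjoint A v) 0.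
  by rewrite rnorm0 mulr_ge0 ?rnorm_ge0// ltW.
rewrite -rnorm_gt0 => adj0.
rewrite -(ler_pM2l adj0) -expr2 -Re_innerxx -adjointP.
rewrite (le_trans (Re_inner_le _ _))// mulrA (mulrC _ M).
by rewrite ler_wpM2r ?rnorm_ge0.
Qed.

End adjoints.

(** * Uniform boundedness *)
Section uniform_boundedness.
Context {R : realType} {V : completeNormedModType R[i]}.
Context {W : normedModType R[i]}.

(** If the family is bounded by some constant on some ball, linearity spreads the
    bound to all of V.  Otherwise one builds nested closed balls, of radii
    tending to 0, such that throughout the (n+1)-st ball some member of the
    family exceeds n; at the common point of these balls the family is not
    bounded. *)
Lemma uniform_boundedness I (D : set I) (A : I -> V -> W) :
    (forall i, D i -> linear (A i)) ->
    (forall i, D i ->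
       exists2 M : R, 0 < M & forall x, rnorm (A i x) <= M * rnorm x) ->
    (forall x, exists C : R, forall i, D i -> rnorm (A i x) <= C) ->
  exists2 C : R, 0 < C & forall i x, D i -> rnorm (A i x) <= C * rnorm x.
Proof.
move=> linA bndA ptwA.
have [[C [x [r r0 xrC]]]|unbdd] := pselect (exists C x, exists2 r : R, 0 < r &
    forall y i, rnorm (x - y) < r -> D i -> rnorm (A i y) <= C).
  have C0 : 0 <= `|C| * 2 * 2 / r.
    by rewrite !mulr_ge0// invr_ge0 ltW.
  exists (`|C| * 2 * 2 / r + 1) => [|i y Di]; first by rewrite ltr_wpDl.
  apply: (@le_trans _ _ (`|C| * 2 * 2 / r * rnorm y)); last first.
    by rewrite ler_wpM2r ?rnorm_ge0// lerDl.
  apply: linear_boundedP => // [|z zr]; first exact: linA.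
  have -> : A i z = A i (x + z) - A i x.
    by rewrite (linear_funD (linA _ Di)) addrAC subrr add0r.
  rewrite (le_trans (ler_rnormB _ _))// mulr_natr mulr2n lerD//.
    rewrite (le_trans _ (ler_norm _))// xrC//.
    by rewrite opprD addNKr rnormN.
  by rewrite (le_trans _ (ler_norm _))// xrC// subrr rnorm0.
exfalso.
have /choice[f fP] : forall nxr : nat * (V * R), exists yr : V * R,
    0 < nxr.2.2 ->
    [/\ 0 < yr.2, yr.2 <= nxr.1.+1%:R^-1,
       forall z, rnorm (yr.1 - z) <= yr.2 -> rnorm (nxr.2.1 - z) <= nxr.2.2 &
       forall z, rnorm (yr.1 - z) <= yr.2 ->
         exists2 i, D i & nxr.1%:R < rnorm (A i z)].
  move=> [n [x r]] /=; have [r0|] := ltP 0 r; last by exists (x, r).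
  have [[y [i [xy Di nA]]]|] :=
      pselect (exists y i, [/\ rnorm (x - y) < r, D i & n%:R < rnorm (A i y)]).
    have [M M0 AM] := bndA i Di.
    (* The three bounds on the radius make it tend to 0, keep the new ball inside
       the old one, and keep A i above n on the whole new ball. *)
    exists (y, Num.min n.+1%:R^-1 (Num.min (r - rnorm (x - y))
      ((rnorm (A i y) - n%:R) / M / 2))) => _ /=; split.
    - by rewrite !lt_min invr_gt0 ltr0Sn subr_gt0 xy !divr_gt0// subr_gt0.
    - by rewrite ge_min lexx.
    - move=> z; rewrite !le_min => /and3P[_ yz _].
      by rewrite (le_trans (ler_rdistD y _ _))// -lerBrDl.
    - move=> z; rewrite !le_min => /and3P[_ _].
      rewrite ler_pdivlMr// ler_pdivlMr// => yz; exists i => //.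
      have := AM (y - z); rewrite (linear_funB (linA _ Di)) => yzM.
      have := ler_rnormD (A i y - A i z) (A i z); rewrite subrK => yzz.
      have : 0 < rnorm (A i y) - n%:R by rewrite subr_gt0.
      move: yz yzM yzz; move: (rnorm (A i y)) (rnorm (A i z)) (n%:R : R).
      move: (rnorm (y - z)) (rnorm (_ - _)) => a b c d e; nra.
  move=> H; exfalso; apply: unbdd; exists n%:R, x, r => // y i xyr Di.
  by rewrite leNgt; apply/negP => nA; apply: H; exists y, i.
pose fix s n := if n is n.+1 then f (n, s n) else (0 : V, 1 : R).
have s0 n : 0 < (s n).2.
  by elim: n => [|n IHn]; [exact: ltr01|have [] := fP (n, s n) IHn].
have sS n : [/\ (s n.+1).2 <= n.+1%:R^-1,
    forall z, rnorm ((s n.+1).1 - z) <= (s n.+1).2 ->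
       rnorm ((s n).1 - z) <= (s n).2 &
    forall z, rnorm ((s n.+1).1 - z) <= (s n.+1).2 ->
         exists2 i, D i & n%:R < rnorm (A i z)].
  by have [] := fP (n, s n) (s0 n).
have nested n m z : (n <= m)%N ->
    rnorm ((s m).1 - z) <= (s m).2 -> rnorm ((s n).1 - z) <= (s n).2.
  move=> nm; rewrite -(subnK nm); elim: (m - n)%N => [//|k IHk].
  by have [_ + _] := sS (k + n)%N => /[apply]; exact: IHk.
have s_dist n m : (n <= m)%N -> rnorm ((s n).1 - (s m).1) <= (s n).2.
  by move=> nm; apply: (nested n m) => //; rewrite subrr rnorm0 ltW.
have [l s_l] : exists l : V, (fun n => (s n).1) @ \oo --> l.
  apply: cauchy_seq_rnorm_cvg => e e0.
  exists (Num.truncn e^-1).+1 => n Nn.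
  apply: le_lt_trans (s_dist _ _ Nn) _; have [+ _ _] := sS (Num.truncn e^-1).
  move=> /le_lt_trans; apply.
  by rewrite -ltf_pV2 ?posrE ?invr_gt0// invrK truncnS_gt.
have [C AC] := ptwA l.
have [_ _ /(_ l)] := sS (Num.truncn `|C|).+1.
set n := (_.+2); case=> [|i Di].
  apply/ler_addgt0Pr => e e0; near \oo => m.
  apply: le_trans (ler_rdistD (s m).1 _ _) _; apply: lerD.
    by apply: s_dist; near: m; exact: nbhs_infty_ge.
  rewrite rnorm_distC; apply: ltW; near: m.
  by move/cvg_rnormP : s_l; apply.
apply/negP; rewrite -leNgt (le_trans (AC i Di))// (le_trans (ler_norm _))//.
exact/ltW/truncnS_gt.
Unshelve. all: by end_near. Qed.

End uniform_boundedness.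

(** * Total boundedness through finite partitions *)
Section finite_partitions.
Context {R : realType}.

(** Total boundedness in a form that needs no centres; c is a colouring of the
    points, and d stands for being close. *)
Definition finitely_split (T : Type) (A : set T) (d : T -> T -> Prop) :=
  exists (I : finType) (c : T -> I),
    forall u v, A u -> A v -> c u = c v -> d u v.

(** Each g k takes its values in [-M, M], which is cut into intervals of length d;
    the colour of u records, for every k, the interval that contains g k u. *)
Lemma bounded_finitely_split (K : eqType) (s : seq K) T (A : set T)
    (g : K -> T -> R) (M d : R) : 0 < d ->
    (forall k u, k \in s -> A u -> `|g k u| <= M) ->
  finitely_split A (fun u v => forall k, k \in s -> `|g k u - g k v| <= d).
Proof.
move=> d0; elim: s => [|k s IHs] gM; first by exists unit, (fun=> tt).
have [k' u k's Au|I [c cP]] := IHs.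
  by apply: gM => //; rewrite inE k's orbT.
pose N := Num.truncn ((M + M) / d).
pose t u : nat := Num.truncn ((g k u + M) / d).
exists ('I_N.+1 * I)%type, (fun u => (inord (t u), c u)).
move=> u v Au Av [] tuv cuv k'.
have tN w : A w -> (t w < N.+1)%N /\ 0 <= (g k w + M) / d.
  move=> Aw; have := gM k w; rewrite inE eqxx => /(_ isT Aw).
  rewrite ler_norml => /andP[gm gM']; split.
    by rewrite ltnS le_truncn// ler_pM2r ?invr_gt0// lerD2r.
  by rewrite divr_ge0 ?(ltW d0)// -lerBlDr sub0r.
rewrite inE => /predU1P[->|]; last exact: cP.
have {}tuv : t u = t v.
  have [tu _] := tN u Au; have [tv _] := tN v Av.
  by rewrite -(inordK tu) tuv inordK.
have /andP[lu uu] := truncn_itv (tN u Au).2.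
have /andP[lv uv] := truncn_itv (tN v Av).2.
rewrite -/(t u) -/(t v) tuv in lu uu lv uv.
move: lu uu lv uv; rewrite !ler_pdivlMr// !ltr_pdivrMr// -natr1 mulrDl mul1r.
move: ((t v)%:R * d) => a; rewrite ler_norml => ? ? ? ?; apply/andP; split; lra.
Qed.

Lemma bounded_complex_finitely_split (K : eqType) (s : seq K) T (A : set T)
    (g : K -> T -> R[i]) (M d : R) : 0 < d ->
    (forall k u, k \in s -> A u -> rnorm (g k u) <= M) ->
  finitely_split A (fun u v => forall k, k \in s -> rnorm (g k u - g k v) <= d).
Proof.
move=> d0 gM.
pose g' (kb : K * bool) u := if kb.2 then Re (g kb.1 u) else Im (g kb.1 u).
have [|[k b] u /allpairsP[[k' b'] /= [k's _ [-> ->]]] Au|I [c cP]] :=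
    @bounded_finitely_split _ [seq (k, b) | k <- s, b <- [:: true; false]] T A
      g' M (d / 2).
- by rewrite divr_gt0.
- rewrite /g'/=; apply: le_trans (gM k' u k's Au).
  by case: b'; [exact: ler_Re_rnorm|exact: ler_Im_rnorm].
exists I, c => u v Au Av cuv k ks.
apply: le_trans (rnorm_le_ReIm _) _; rewrite cReD cImD cReN cImN (splitr d) lerD//.
- by apply: (cP u v Au Av cuv (k, true)); apply: allpairs_f.
- by apply: (cP u v Au Av cuv (k, false)); apply: allpairs_f.
Qed.

(** One point is picked in each piece; a colour that A does not use yields the
    default value 0, which does no harm. *)
Lemma finitely_split_net (V : normedZmodType R[i]) (A : set V) (e : R) :
    finitely_split A (fun u v => rnorm (u - v) <= e) ->
  exists s : seq V, forall u, A u -> exists2 x, x \in s & rnorm (u - x) <= e.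
Proof.
move=> [I [c cP]].
exists [seq xget 0 [set v | A v /\ c v = i] | i <- enum I] => u Au.
exists (xget 0 [set v | A v /\ c v = c u]).
  by apply: map_f; rewrite mem_enum.
by case: xgetP => [x _ [Ax cxu]|/(_ u)[]//]; exact: cP.
Qed.

(** An ultrafilter containing the closure of A contains a ball of each radius,
    because finitely many such balls cover A; hence it is Cauchy. *)
Lemma split_compact_closure (V : completeNormedModType R[i]) (A : set V) :
    (forall e : R, 0 < e -> finitely_split A (fun u v => rnorm (u - v) <= e)) ->
  compact (closure A).
Proof.
move=> splitA; rewrite compact_ultra => F UF FA.
suff [l Fl] : exists l : V, F --> l.
  exists l; split => //; apply: (@closed_cvg _ _ F _ id (closure A)) => //.
  exact: closed_closure.
apply: cauchy_rnorm_cvg => e e0.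
have e20 : 0 < e / 4 by rewrite divr_gt0.
have [s sP] := finitely_split_net (splitA _ e20).
have : F (\bigcup_(x in [set` s]) [set y | rnorm (x - y) < e]).
  apply: filterS FA => y /closure_rnorm/(_ _ e20)[z /sP[x xs zx] yz].
  exists x => //=; rewrite rnorm_distC.
  by have := ler_rdistD z y x; lra.
elim: s {sP} => [|x s IHs].
  by move=> /filterS F0; exfalso; apply: (@filter_not_empty _ F); apply: F0 => y [].
move=> Fxs.
have [Fx|FNx] := in_ultra_setVsetC [set y | rnorm (x - y) < e] UF.
  by exists x.
apply: IHs; apply: filterS (filterI Fxs FNx) => y [] [z /=].
by rewrite inE => /predU1P[-> xy /(_ xy)//|zs zy _]; exists z.
Qed.

Lemma compact_net (V : completeNormedModType R[i]) (A : set V) (e : R) :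
    compact (closure A) -> 0 < e ->
  exists s : seq V, forall u, A u -> exists2 x, x \in s & rnorm (u - x) < e.
Proof.
rewrite compact_cover => cA e0.
have [||D _ AD] := cA V setT (fun x => [set y | rnorm (x - y) < e]).
- move=> x _; rewrite openE => y /= xy.
  apply/nbhs_rnorm; exists (e - rnorm (x - y)); rewrite ?subr_gt0// => z yz.
  by rewrite /= (le_lt_trans (ler_rdistD y _ _))// -ltrBrDl.
- by move=> x _; exists x => //=; rewrite subrr rnorm0.
exists (enum_fset D) => u /subset_closure/AD[x Dx /= xu].
by exists x => //; rewrite rnorm_distC.
Qed.

End finite_partitions.

(** * Square-integrable functions and their tails *)
Section complex_continuity.
Context {R : realType} {X : topologicalType}.

Lemma continuous_realP (f : X -> R) :
  continuous f <->
  forall s (e : R), 0 < e -> \forall t \near s, `|f s - f t| < e.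
Proof.
split=> [cf s e e0|fe s]; first by move: (cf s) => /cvgrPdist_lt; exact.
by apply/cvgrPdist_lt => e; exact: fe.
Qed.

Lemma continuous_rnormP (V : pseudoMetricNormedZmodType R[i]) (f : X -> V) :
  continuous f <->
  forall s (e : R), 0 < e -> \forall t \near s, rnorm (f s - f t) < e.
Proof.
split=> [cf s e e0|fe s]; first by move: (cf s) => /cvg_rnormP; exact.
by apply/cvg_rnormP => e; exact: fe.
Qed.

Lemma continuous_ReImP (f : X -> R[i]) :
  continuous (f : X -> R[i]^o) <->
  continuous (fun s => Re (f s)) /\ continuous (fun s => Im (f s)).
Proof.
split=> [/continuous_rnormP cf|[/continuous_realP cRe /continuous_realP cIm]].
  split; apply/continuous_realP => s e e0;
    apply: filterS (cf s e e0) => t; apply: le_lt_trans.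
    by rewrite -cReN -cReD ler_Re_rnorm.
  by rewrite -cImN -cImD ler_Im_rnorm.
apply/continuous_rnormP => s e e0; have e20 : 0 < e / 2 by rewrite divr_gt0.
apply: filterS2 (cRe s _ e20) (cIm s _ e20) => t re im.
apply: le_lt_trans (rnorm_le_ReIm _) _.
by rewrite cReD cImD cReN cImN (splitr e) ltrD.
Qed.

End complex_continuity.

Section square_integrable.
Context {R : realType} {X : ptopologicalType}.
Variable mu : {measure set (borel X) -> \bar R}.
Implicit Types f g : X -> R[i].

Lemma borel_open (U : set X) : open U -> measurable (U : set (borel X)).
Proof. by move=> oU; apply: sub_sigma_algebra. Qed.

Lemma borel_closed (U : set X) : closed U -> measurable (U : set (borel X)).
Proof. by move=> /closed_openC/borel_open/measurableC; rewrite setCK. Qed.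

Lemma continuous_borel (f : X -> R) :
  continuous f -> measurable_fun setT (f : borel X -> R).
Proof.
move=> /continuousP cf; apply: (measurability _ (RGenOpens.measurableE R)).
move=> _ [_ [a [b ->] <-]]; rewrite setTI; apply: borel_open.
exact/cf/interval_open.
Qed.

Definition borel_complex f :=
  measurable_fun setT ((fun s => Re (f s)) : borel X -> R) /\
  measurable_fun setT ((fun s => Im (f s)) : borel X -> R).

Lemma continuous_borel_complex f :
  continuous (f : X -> R[i]^o) -> borel_complex f.
Proof. by move=> /continuous_ReImP[? ?]; split; exact: continuous_borel. Qed.

Lemma borel_complexD f g :
  borel_complex f -> borel_complex g -> borel_complex (fun s => f s + g s).
Proof.
move=> [Rf If] [Rg Ig]; split.
  by under eq_fun do rewrite cReD; exact: measurable_funD.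
by under eq_fun do rewrite cImD; exact: measurable_funD.
Qed.

Lemma borel_complexM f g :
  borel_complex f -> borel_complex g -> borel_complex (fun s => f s * g s).
Proof.
move=> [Rf If] [Rg Ig]; split.
  by under eq_fun do rewrite cReM; apply: measurable_funB; exact: measurable_funM.
by under eq_fun do rewrite cImM; apply: measurable_funD; exact: measurable_funM.
Qed.

Lemma borel_complex_cst (a : R[i]) : borel_complex (fun=> a).
Proof. by split; exact: measurable_cst. Qed.

Lemma borel_complexB f g :
  borel_complex f -> borel_complex g -> borel_complex (fun s => f s - g s).
Proof.
move=> mf mg; under [X in borel_complex X]eq_fun do rewrite -mulN1r.
by apply: borel_complexD => //; apply: borel_complexM => //; exact: borel_complex_cst.
Qed.

Lemma borel_complex_indic (L : set X) :
  measurable (L : set (borel X)) -> borel_complex (fun s => \1_L s).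
Proof.
move=> mL; have RL s : (\1_L s : R[i]) = (\1_L s)%:C%C.
  by rewrite !indicE; case: (_ \in _).
split; under eq_fun do rewrite RL /=; last exact: measurable_cst.
exact: (@measurable_indic _ (borel X) R).
Qed.

Lemma borel_rnorm2 f : borel_complex f ->
  measurable_fun setT ((fun s => (rnorm (f s) ^+ 2)%:E) : borel X -> \bar R).
Proof.
move=> [Rf If]; apply/measurable_EFinP.
under eq_fun do rewrite rnorm_sqr.
by apply: measurable_funD; exact: measurable_funX.
Qed.

(** The square of [L2norm], which avoids square roots and real powers. *)
Definition L2sq f : \bar R := (\int[mu]_s (rnorm (f s) ^+ 2)%:E)%E.

Lemma poweR_L2norm f : (L2norm mu f `^ 2 = L2sq f)%E.
Proof.
rewrite poweR_Lnorm//; apply: eq_integral => s _ /=.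
by rewrite ger0_norm ?rnorm_ge0// powR_mulrn ?rnorm_ge0.
Qed.

Lemma L2norm_le f (M : R) : 0 <= M ->
  (L2norm mu f <= M%:E)%E = (L2sq f <= (M ^+ 2)%:E)%E.
Proof.
move=> M0; rewrite -poweR_L2norm.
have : (0 <= L2norm mu f)%E by exact: Lnorm_ge0.
case: (L2norm mu f) => [x| |]//; last by rewrite poweRyr// !leye_eq.
rewrite !lee_fin => x0; rewrite powR_mulrn//.
by rewrite ler_pXn2r// nnegrE.
Qed.

Lemma L2sq_eq f (M : R) : L2norm mu f = M%:E -> L2sq f = (M ^+ 2)%:E.
Proof.
move=> fM; rewrite -poweR_L2norm fM poweR_EFin powR_mulrn//.
by rewrite -lee_fin -fM Lnorm_ge0.
Qed.

Lemma L2P f : L2 mu f <-> borel_complex f /\ (L2sq f < +oo)%E.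
Proof.
have -> : (L2sq f < +oo)%E <-> (L2norm mu f < +oo)%E.
  rewrite -poweR_L2norm; split; first exact: lty_poweRy.
  exact: poweR_lty.
by split=> [[? ? ?]|[[? ?] ?]]; split.
Qed.

Lemma ae_L2sq f g : borel_complex f -> borel_complex g ->
  ae_equal mu f g -> L2sq f = L2sq g.
Proof.
move=> mf mg fg; apply: ge0_ae_eq_integral => //; try exact: borel_rnorm2.
- by move=> s _; rewrite lee_fin; exact: sqr_ge0.
- by move=> s _; rewrite lee_fin; exact: sqr_ge0.
- by apply: filterS fg => s /= ->.
Qed.

Lemma le_L2sq f g : borel_complex f -> borel_complex g ->
  (forall s, rnorm (f s) <= rnorm (g s)) -> (L2sq f <= L2sq g)%E.
Proof.
move=> mf mg fg; apply: ge0_le_integral => //; try exact: borel_rnorm2.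
- by move=> s _; rewrite lee_fin; exact: sqr_ge0.
- by move=> s _ /=; rewrite lee_fin ler_pXn2r ?nnegrE ?rnorm_ge0.
Qed.

Lemma rnorm_cutoff (L : set X) (f : X -> R[i]) s :
  rnorm (\1_L s * f s - f s) = if s \in L then 0 else rnorm (f s).
Proof.
rewrite indicE; case: ifPn => _; first by rewrite mul1r subrr rnorm0.
by rewrite mul0r sub0r rnormN.
Qed.

Definition exhaustion (K : nat -> set X) (n : nat) : set X :=
  \big[setU/set0]_(i < n) K i.

Lemma compact_exhaustion K n :
  (forall i, compact (K i)) -> compact (exhaustion K n).
Proof. by move=> cK; exact: bigsetU_compact. Qed.

(** Dominated convergence: the integrands are at most |f|^2, and at a given s
    they vanish as soon as the exhaustion reaches s. *)
Lemma L2_tail (K : nat -> set X) f (e : R) : hausdorff_space X ->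
    (forall i, compact (K i)) -> \bigcup_i K i = setT -> L2 mu f -> 0 < e ->
  \forall n \near \oo,
    (L2sq (fun s => \1_(exhaustion K n) s * f s - f s)%R <= e%:E)%E.
Proof.
move=> hX cK KT /L2P[mf fy] e0.
have mL n : measurable (exhaustion K n : set (borel X)).
  by apply: borel_closed; apply: compact_closed => //; exact: compact_exhaustion.
pose tail n s := (rnorm (\1_(exhaustion K n) s * f s - f s) ^+ 2)%:E.
have mtail n : measurable_fun setT (tail n : borel X -> \bar R).
  apply: borel_rnorm2; apply: borel_complexB => //.
  by apply: borel_complexM => //; exact: borel_complex_indic.
have : (\int[mu]_s tail n s)%E @[n --> \oo] --> (\int[mu]_s (cst 0 s))%E.
  apply: (@dominated_cvg _ _ _ mu setT measurableT tail (cst 0)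
    (fun s => (rnorm (f s) ^+ 2)%:E)) => //.
  - move=> s _; have [i _ Kis] : (\bigcup_i K i) s by rewrite KT.
    apply: cvg_near_cst; exists i.+1 => // n /= ltin.
    rewrite /tail rnorm_cutoff ifT ?expr0n//.
    by rewrite inE /exhaustion -bigcup_mkord; exists i.
  - apply/integrableP; split; first exact: borel_rnorm2.
    under eq_integral do rewrite gee0_abs ?lee_fin ?sqr_ge0//.
    exact: fy.
  - move=> n s _; rewrite gee0_abs ?lee_fin ?sqr_ge0// rnorm_cutoff.
    by case: ifP; rewrite ?expr0n// sqr_ge0.
rewrite integral0 => /fine_cvgP[fintail /cvgrPdist_lt/(_ _ e0) tail0].
apply: filterS2 fintail tail0 => n ftail; rewrite sub0r normrN /=.
rewrite -[(L2sq _)](fineK ftail) lee_fin => /ltW; apply: le_trans.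
exact: ler_norm.
Qed.

End square_integrable.

(** * Bump functions on locally compact Hausdorff spaces *)
Section bump_functions.
Context {R : realType} {X : ptopologicalType}.
Hypothesis hX : hausdorff_space X.
Hypothesis lcX : locally_compact [set: X].

Definition bump (k : X -> R) (C : set X) :=
  [/\ continuous k, forall s, 0 <= k s <= 1, compact C &
      forall s, ~ C s -> k s = 0].

(** A locally compact Hausdorff space is completely regular: separate s0 from the
    complement of the intersection of U with the interior of a compact
    neighbourhood C of s0. *)
Lemma bump_point (s0 : X) (U : set X) : open U -> U s0 ->
  exists k C, [/\ bump k C, k s0 = 1 & forall s, ~ U s -> k s = 0].
Proof.
move=> oU Us0; have [C s0C [cC _]] : compact_near (nbhs s0).
  by have := @lcX s0 I; rewrite withinET.
have oUC : open (U `&` C°) by apply: openI => //; exact: open_interior.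
have := @locally_compact_completely_regular X R lcX hX s0 (~` (U `&` C°)).
move=> /(_ (open_closedC oUC)) /(_ _)/(@uniform_separatorP X R).
case=> [|f [cf f01 f0 f1]]; first by apply; split.
have fI s : 0 <= f s <= 1.
  by have /f01 : range f (f s) by []; rewrite /= in_itv.
have fU s : ~ (U `&` C°) s -> 1 - f s = 0.
  by move=> nUC; rewrite (f1 (f s)) ?subrr//; exists s.
exists (fun s => 1 - f s), C; split.
- split=> // [s|s|s nC].
  + by apply: continuousB; [exact: cvg_cst|exact: cf].
  + by have := fI s; lra.
  + by apply: fU => -[_ /interior_subset].
- by rewrite (f0 (f s0)) ?subr0//; exists s0.
- by move=> s nU; apply: fU => -[].
Qed.

(** Finitely many of the sets where the pointwise bump functions exceed 1/2 cover
    L, so twice the sum of these functions is at least 1 on L and can be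
    truncated at 1. *)
Lemma bump_compact (L : set X) : compact L ->
  exists k C, bump k C /\ forall s, L s -> k s = 1.
Proof.
rewrite compact_cover => cL.
have /choice[kC kCP] : forall s0, exists kC : (X -> R) * set X,
    bump kC.1 kC.2 /\ kC.1 s0 = 1.
  by move=> s0; have [k [C [? ? _]]] := @bump_point s0 setT openT I; exists (k, C).
pose k s0 := (kC s0).1; pose C s0 := (kC s0).2.
have kP s0 : bump (k s0) (C s0) by have [] := kCP s0.
have k1 s0 : k s0 s0 = 1 by have [] := kCP s0.
have k0 s0 s : 0 <= k s0 s by have [_ /(_ s)/andP[]] := kP s0.
have [||D _ LD] := cL X setT (fun s0 => [set s | 2^-1 < k s0 s]).
- move=> s0 _; have [ck _ _ _] := kP s0.
  by apply: (@open_comp _ _ (k s0) [set y | 2^-1 < y]) => // s _; exact: ck.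
- by move=> s _; exists s => //=; rewrite k1 invf_lt1// ltr1n.
pose S s := 2 * \sum_(s0 <- enum_fset D) k s0 s.
have S0 s : 0 <= S s by rewrite mulr_ge0// sumr_ge0.
exists (fun s => Num.min 1 (S s)), (\big[setU/set0]_(s0 <- enum_fset D) C s0).
split=> [|s /LD[s0 s0D /= k2]]; last first.
  apply/min_idPl; rewrite /S (big_rem s0)//= mulrDr.
  rewrite (le_trans (_ : _ <= 2 * k s0 s)) ?lerDl ?mulr_ge0 ?sumr_ge0//.
  by rewrite mulrC -ler_pdivrMr// mul1r ltW.
split.
- have cS : continuous S.
    move=> s; rewrite /S; apply: cvgMl_tmp.
    apply: (cvg_big (op := +%R)); first exact: add_continuous.
    by move=> s0 _; have [ck _ _ _] := kP s0; exact: ck.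
  by move=> s; apply: (@continuous_min _ _ (cst 1) S); [exact: cvg_cst|exact: cS].
- by move=> s; rewrite le_min ler01 S0 ge_min lexx.
- by apply: bigsetU_compact => s0 _; have [] := kP s0.
- move=> s nC; rewrite /S big_seq big1 ?mulr0 ?(min_idPr _)// => s0 s0D.
  have [_ _ _] := kP s0; apply; apply: contra_not nC => Cs.
  by rewrite -bigcup_seq; exists s0.
Qed.

Lemma Cc_bump (k : X -> R) (C : set X) (f : X -> R[i]) :
    bump k C -> continuous (f : X -> R[i]^o) ->
  Cc (fun s => (k s)%:C%C * f s).
Proof.
move=> [ck _ cC k0] /continuous_ReImP[cRe cIm]; split.
  apply/continuous_ReImP; split => s.
    by under eq_fun do rewrite cReZ; apply: continuousM; [exact: ck|exact: cRe].
  under eq_fun do rewrite cImM /= mul0r addr0.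
  by apply: continuousM; [exact: ck|exact: cIm].
apply: (subclosed_compact _ cC); first exact: closed_closure.
rewrite [X in _ `<=` X](closure_id C).1; last exact: compact_closed.
apply: closure_subset => s /=; apply: contra_neqP => nC.
by rewrite k0// mul0r.
Qed.

End bump_functions.

(** * Hilbert-Schmidt operators as tensors *)
Section total_sets.
Context {R : realType} {H : hilbertType R}.

(** A continuous linear functional that vanishes on a total set vanishes; the
    functional is a plain function here, to be applied to differences of two
    sides of an identity. *)
Lemma total_eq0 (E : set H) (f : H -> R[i]) (C : R) :
    closure (lin_span E) = setT ->
    (forall a u v, f (a *: u + v) = a * f u + f v) ->
    (forall u, rnorm (f u) <= C * rnorm u) ->
    (forall u, E u -> f u = 0) ->
  forall u, f u = 0.
Proof.
move=> ET linf fC fE u; apply/eqP; rewrite -rnorm_eq0 eq_le rnorm_ge0 andbT.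
have C1 : 0 < `|C| + 1 by rewrite ltr_wpDl.
apply/ler_addgt0Pr => e e0; rewrite add0r.
have : closure (lin_span E) u by rewrite ET.
have eC : 0 < e / (`|C| + 1) by rewrite divr_gt0.
move=> /closure_rnorm/(_ _ eC)[_ [s [sE ->]] us].
have f0 : f 0 = 0.
  by have := linf (-1) 0 0; rewrite scaler0 addr0 mulN1r addNr.
have fs : f (\sum_(p <- s) p.1 *: p.2) = 0.
  elim: s sE {us} => [|p s IHs] sE; first by rewrite big_nil.
  rewrite big_cons linf fE ?mulr0 ?add0r; last by apply: sE; rewrite inE eqxx.
  by apply: IHs => q qs; apply: sE; rewrite inE qs orbT.
have -> : f u = f (u - \sum_(p <- s) p.1 *: p.2).
  by rewrite addrC -scaleN1r linf fs mulr0 add0r.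
rewrite (le_trans (fC _))//.
apply: (@le_trans _ _ ((`|C| + 1) * rnorm (u - \sum_(p <- s) p.1 *: p.2))).
  rewrite ler_wpM2r ?rnorm_ge0// (le_trans (ler_norm _))// lerDl.
  exact: ler01.
by rewrite mulrC -ler_pdivlMr// ltW.
Qed.

End total_sets.

Section tensor.
Context {R : realType} {H : hilbertType R}.
Variable T : hilbertTensor H (conj_space H).
Implicit Types (u v x y : H) (psi : T).

(** The second factors are swapped because the inner product of the conjugate
    space is the flipped one. *)
Lemma inner_tens u v x y :
  inner (tens T u v) (tens T x y) = inner u x * inner y v.
Proof. exact: tens_inner. Qed.

Lemma rnorm_tens u v : rnorm (tens T u v) = rnorm u * rnorm v.
Proof.
apply/eqP; rewrite -(@eqrXn2 _ 2)// ?mulr_ge0 ?rnorm_ge0//.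
by rewrite -Re_innerxx inner_tens !innerxx -real_complexM exprMn.
Qed.

(** Linear in the second slot of the tensor, although [inner psi] is
    conjugate-linear: that slot lives in the conjugate space, and the two
    conjugations cancel. *)
Lemma inner_tens_conjlinear psi y (a : R[i]) u v :
  inner psi (tens T y (a *: u + v)) =
  a * inner psi (tens T y u) + inner psi (tens T y v).
Proof.
have -> : tens T y (a *: u + v) = a^* *: tens T y u + tens T y v.
  have := tens_linearr T y (a^*) u v.
  by congr (tens T y _ = _); rewrite /GRing.scale/= /conj_scale conjCK.
by rewrite innerDr innerZr conjCK.
Qed.

Lemma tens_dense psi (e : R) : 0 < e -> exists s : seq (R[i] * (H * H)),
  rnorm (psi - \sum_(p <- s) p.1 *: tens T p.2.1 p.2.2) < e.
Proof.
move=> e0; have : closure (lin_span [set t | exists u v, t = tens T u v]) psi.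
  by rewrite tens_total.
move=> /closure_rnorm/(_ _ e0)[_ [s [sE ->]]].
suff [s' ->] : exists s' : seq (R[i] * (H * H)), \sum_(p <- s) p.1 *: p.2 =
    \sum_(p <- s') p.1 *: tens T p.2.1 p.2.2 by exists s'.
elim: s sE => [|[a t] s IHs] sE; first by exists [::]; rewrite !big_nil.
have [|s' s's] := IHs; first by move=> p ps; apply: sE; rewrite inE ps orbT.
have [|u [v /= tuv]] := sE (a, t); first by rewrite inE eqxx.
by exists ((a, (u, v)) :: s'); rewrite !big_cons s's tuv.
Qed.

Section Lambda.
Variable Lambda : T -> H -> H.
Hypothesis HLambda : is_Lambda Lambda.

Lemma Lambda_linear (a : R[i]) psi chi x :
  Lambda (a *: psi + chi) x = a *: Lambda psi x + Lambda chi x.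
Proof. by have [] := HLambda. Qed.

Lemma Lambda_operator psi : bounded_operator (Lambda psi).
Proof. by have [/(_ psi)[]] := HLambda. Qed.

Lemma LambdaB psi chi x : Lambda (psi - chi) x = Lambda psi x - Lambda chi x.
Proof. by rewrite addrC -scaleN1r Lambda_linear scaleN1r addrC. Qed.

Lemma Lambda0 x : Lambda 0 x = 0.
Proof. by have := LambdaB 0 0 x; rewrite !subrr. Qed.

Lemma Lambda_sum (s : seq (R[i] * (H * H))) x :
  Lambda (\sum_(p <- s) p.1 *: tens T p.2.1 p.2.2) x =
  \sum_(p <- s) (p.1 * inner x p.2.2) *: p.2.1.
Proof.
have [_ _ _ _ Lt] := HLambda.
elim: s => [|p s IHs]; first by rewrite !big_nil Lambda0.
by rewrite !big_cons Lambda_linear Lt IHs scalerA.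
Qed.

Lemma exists_orthonormal_basis : exists E : set H, orthonormal_basis E.
Proof. by have [/(_ 0)[_ [E]]] := HLambda; exists E. Qed.

(** For simple tensors both sides are <x, v> <u, y>.  For x in an orthonormal
    basis the Hilbert-Schmidt norm dominates |Lambda psi x|, so both sides are
    continuous in psi and agree for all psi.  For fixed psi both sides are
    continuous and linear in x, so they agree for all x. *)
Lemma Lambda_inner psi x y : inner (Lambda psi x) y = inner psi (tens T y x).
Proof.
have [E onE] := exists_orthonormal_basis.
have LE psi' e : E e -> rnorm (Lambda psi' e) <= rnorm psi'.
  move=> Ee; rewrite -(@ler_pXn2r _ 2)// ?nnegrE ?rnorm_ge0// -lee_fin.
  have [_ _ /(_ psi' E onE) <- _ _] := HLambda.
  apply: esum_ge; exists [set e]; first by split; [exact: finite_set1|move=> _ ->].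
  by rewrite fsbig_set1.
have onbasis e : E e -> inner (Lambda psi e) y = inner psi (tens T y e).
  move=> Ee; apply/eqP; rewrite -subr_eq0; apply/eqP; move: psi.
  apply: (total_eq0 (C := rnorm y + rnorm (tens T y e)) (tens_total T)).
  - move=> a psi1 psi2.
    by rewrite Lambda_linear !inner_linearl mulrBr opprD addrACA.
  - move=> psi; rewrite (le_trans (ler_rnormB _ _))// mulrDl.
    apply: lerD.
      rewrite (le_trans (cauchy_schwarz _ _))// mulrC.
      by rewrite ler_wpM2l ?rnorm_ge0// LE.
    by rewrite (le_trans (cauchy_schwarz _ _))// mulrC.
  - move=> _ [u [v ->]]; have [_ _ _ _ ->] := HLambda.
    by rewrite innerZl inner_tens mulrC subrr.
apply/eqP; rewrite -subr_eq0; apply/eqP; move: x.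
have [M M0 LM] := bounded_operator_rnorm (Lambda_operator psi).
apply: (total_eq0 (C := M * rnorm y + rnorm psi * rnorm y) (proj2 onE)).
- move=> a u v; rewrite (proj1 (Lambda_operator psi)) inner_linearl.
  by rewrite inner_tens_conjlinear mulrBr opprD addrACA.
- move=> u; rewrite (le_trans (ler_rnormB _ _))// mulrDl.
  apply: lerD; rewrite (le_trans (cauchy_schwarz _ _))//.
    by rewrite mulrAC ler_wpM2r ?rnorm_ge0.
  by rewrite rnorm_tens mulrA.
- by move=> u Eu; rewrite onbasis// subrr.
Qed.

(** The operator norm is at most the Hilbert-Schmidt norm; take
    y = Lambda psi x in [Lambda_inner]. *)
Lemma Lambda_le psi x : rnorm (Lambda psi x) <= rnorm psi * rnorm x.
Proof.
have [->|] := eqVneq (Lambda psi x) 0.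
  by rewrite rnorm0 mulr_ge0 ?rnorm_ge0.
rewrite -rnorm_gt0 => L0; rewrite -(ler_pM2l L0) -expr2 -Re_innerxx.
rewrite Lambda_inner (le_trans (Re_inner_le _ _))// rnorm_tens.
by rewrite mulrCA.
Qed.

(** Hilbert-Schmidt operators are compact: psi is close to a finite sum of
    simple tensors, whose operator depends on x only through finitely many
    scalar products <x, v>. *)
Lemma Lambda_finitely_split psi (Om : set H) (e : R) : bounded_set Om -> 0 < e ->
  finitely_split Om (fun u v => rnorm (Lambda psi u - Lambda psi v) <= e).
Proof.
move=> /bounded_rnorm[M M0 OmM] e0.
have eM : 0 < e / 2 / (M + M) by rewrite !divr_gt0// addr_gt0.
have [s psis] := tens_dense psi eM.
pose a := \sum_(p <- s) rnorm (p.1 : R[i]) * rnorm p.2.1.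
pose b := \sum_(p <- s) rnorm p.2.2.
have a1 : 0 < a + 1.
  by rewrite ltr_wpDl// sumr_ge0// => p _; rewrite mulr_ge0 ?rnorm_ge0.
have ea : 0 < e / 2 / (a + 1) by rewrite !divr_gt0.
have [|I [c cP]] := @bounded_complex_finitely_split R _ s H Om
    (fun p u => inner u p.2.2) (M * b) _ ea.
  move=> p u ps Omu; rewrite (le_trans (cauchy_schwarz _ _))//.
  apply: ler_pM; rewrite ?rnorm_ge0//; first exact: OmM.
  by rewrite /b (big_rem p)//= lerDl sumr_ge0// => q _; exact: rnorm_ge0.
exists I, c => u v Omu Omv cuv.
rewrite -(linear_funB (proj1 (Lambda_operator psi))).
set phi := \sum_(p <- s) p.1 *: tens T p.2.1 p.2.2 in psis.
have -> : Lambda psi (u - v) = Lambda (psi - phi) (u - v) + Lambda phi (u - v).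
  by rewrite LambdaB subrK.
rewrite (le_trans (ler_rnormD _ _))// (splitr e) lerD//.
  rewrite (le_trans (Lambda_le _ _))//.
  have -> : e / 2 = e / 2 / (M + M) * (M + M) by rewrite divfK// gt_eqF// addr_gt0.
  apply: ler_pM; rewrite ?rnorm_ge0//; first exact: ltW.
  by rewrite (le_trans (ler_rnormB _ _))// lerD// OmM.
rewrite /phi Lambda_sum (le_trans (ler_rnorm_sum _ _))//.
apply: (@le_trans _ _ (a * (e / 2 / (a + 1)))).
  rewrite /a mulr_suml big_seq [leRHS]big_seq; apply: ler_sum => p ps.
  rewrite rnormZ rnormM mulrAC ler_wpM2l ?mulr_ge0 ?rnorm_ge0//.
  by rewrite innerBl; exact: (cP u v Omu Omv cuv p ps).
rewrite mulrC mulrAC ler_pdivrMr// ler_wpM2l ?divr_ge0 ?(ltW e0)//.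
by rewrite lerDl.
Qed.

End Lambda.
End tensor.

(** * Tightness of the coefficient functions and compactness *)
Section sup_over.
Context {R : realType}.

Lemma sup_over_le (U : Type) (A : set U) (F : U -> \bar R) (e : \bar R) :
  (0 <= e)%E -> (sup_over A F <= e)%E <-> forall u, A u -> (F u <= e)%E.
Proof.
move=> e0; split=> [Fe u Au|Fe].
  by apply: le_trans Fe; apply: ereal_sup_ubound; right; exists u.
by apply: ge_ereal_sup => _ [->//|[u Au <-]]; exact: Fe.
Qed.

Lemma sup_over_ge0 (U : Type) (A : set U) (F : U -> \bar R) :
  (0 <= sup_over A F)%E.
Proof. by apply: ereal_sup_ubound; left. Qed.

End sup_over.

Section L2sq_estimates.
Context {R : realType} {X : ptopologicalType}.
Variable mu : {measure set (borel X) -> \bar R}.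

Lemma L2sqD_le (f g : X -> R[i]) (a b : R) :
    borel_complex f -> borel_complex g ->
    (L2sq mu f <= a%:E)%E -> (L2sq mu g <= b%:E)%E ->
  (L2sq mu (fun s => f s + g s)%R <= (2 * (a + b))%:E)%E.
Proof.
move=> mf mg fa gb.
have sq0 (h : X -> R[i]) s : (0 <= (rnorm (h s) ^+ 2)%:E)%E.
  by rewrite lee_fin; exact: sqr_ge0.
rewrite EFinM; apply: (@le_trans _ _ (2%:E * (L2sq mu f + L2sq mu g))%E).
  rewrite /L2sq -ge0_integralD//; [|exact: borel_rnorm2..].
  rewrite -ge0_integralZl//; [|by apply: emeasurable_funD; exact: borel_rnorm2|
    by move=> s _; exact: adde_ge0].
  apply: ge0_le_integral => //.
  - by move=> s _; rewrite lee_fin; exact: sqr_ge0.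
  - by apply: borel_rnorm2; exact: borel_complexD.
  - apply: measurable_funeM; apply: emeasurable_funD; exact: borel_rnorm2.
  - move=> s _; rewrite -EFinD -EFinM lee_fin.
    have : rnorm (f s + g s) ^+ 2 <= (rnorm (f s) + rnorm (g s)) ^+ 2.
      by rewrite ler_pXn2r ?nnegrE ?addr_ge0 ?rnorm_ge0// ler_rnormD.
    move/le_trans; apply; rewrite -subr_ge0.
    have := sqr_ge0 (rnorm (f s) - rnorm (g s)).
    by move=> /le_trans; apply; rewrite le_eqVlt; apply/orP; left; apply/eqP; ring.
by rewrite lee_pmul2l// EFinD; exact: leeD.
Qed.

Lemma L2sq_bounded_support (f : X -> R[i]) (L : set X) (d m : R) :
    measurable (L : set (borel X)) -> mu L = m%:E -> borel_complex f ->
    (forall s, L s -> rnorm (f s) <= d) ->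
    (forall s, ~ L s -> f s = 0) ->
  (L2sq mu f <= (d ^+ 2 * m)%:E)%E.
Proof.
move=> mL Lm mf fd f0; rewrite EFinM -Lm -integral_cst//.
rewrite [leRHS]integral_mkcond; apply: ge0_le_integral => //.
- by move=> s _; rewrite lee_fin; exact: sqr_ge0.
- exact: borel_rnorm2.
- by apply/(measurable_restrictT _ _).1 => //; exact: measurable_cst.
- move=> s _; rewrite patchE; case: ifPn => [/set_mem Ls|/negP nLs].
    rewrite lee_fin ler_pXn2r ?nnegrE ?rnorm_ge0 ?fd//.
    by rewrite (le_trans (rnorm_ge0 _) (fd _ Ls)).
  by rewrite f0 ?rnorm0 ?expr0n//; apply: contra_not nLs => /mem_set.
Qed.

End L2sq_estimates.

(** By [pi_sq], the map [phi pi_ w] is |w| times an isometry from H into L^2. *)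
Section square_integrable_map.
Context {R : realType} {H : hilbertType R} {X : ptopologicalType}.
Variables (mu : {measure set (borel X) -> \bar R}) (pi_ : X -> H -> H).
Hypothesis hX : hausdorff_space X.
Hypothesis scX : sigma_compact X.
Hypothesis finK : forall K : set X, compact K -> (mu K < +oo)%E.
Hypothesis pi_bounded : forall s, bounded_operator (pi_ s).
Hypothesis pi_sq : forall u v : H,
    (\int[mu]_s (rnorm (inner (pi_ s u) v) ^+ 2)%:E
       = (rnorm u ^+ 2 * rnorm v ^+ 2)%:E)%E.
Hypothesis pi_cont : forall u : H,
  continuous (fun s : X => adjoint (pi_ s) u).
Implicit Types (u v w : H) (Om : set H).

Lemma phi_adjoint w u s : phi pi_ w u s = inner u (adjoint (pi_ s) w).
Proof. exact: adjointP. Qed.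

Lemma continuous_phi w u : continuous (phi pi_ w u : X -> R[i]^o).
Proof.
apply/continuous_rnormP => s e e0.
have u1 : 0 < rnorm u + 1 by rewrite ltr_wpDl ?rnorm_ge0.
have eu : 0 < e / (rnorm u + 1) by rewrite divr_gt0.
have /continuous_rnormP/(_ s _ eu) := @pi_cont w.
apply: filterS => t; rewrite ltr_pdivlMr// => st.
rewrite !phi_adjoint; apply: le_lt_trans st.
have -> :
  rnorm (inner u (adjoint (pi_ s) w) - inner u (adjoint (pi_ t) w) : R[i]^o)
  = rnorm (inner u (adjoint (pi_ s) w - adjoint (pi_ t) w)).
  by rewrite innerBr.
rewrite (le_trans (cauchy_schwarz _ _))// mulrC ler_wpM2l ?rnorm_ge0//.
by rewrite lerDl.
Qed.

Lemma borel_phi w u : borel_complex (phi pi_ w u).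
Proof. exact/continuous_borel_complex/continuous_phi. Qed.

Lemma L2sq_phi w u : L2sq mu (phi pi_ w u) = ((rnorm u * rnorm w) ^+ 2)%:E.
Proof. by rewrite exprMn -pi_sq. Qed.

Lemma phiB w u v s : phi pi_ w (u - v) s = phi pi_ w u s - phi pi_ w v s.
Proof. by rewrite !phi_adjoint innerBl. Qed.

Lemma L2_phi w u : L2 mu (phi pi_ w u).
Proof. by apply/L2P; split; [exact: borel_phi|rewrite L2sq_phi ltry]. Qed.

Lemma compact_borel (L : set X) : compact L -> measurable (L : set (borel X)).
Proof. by move=> cL; apply: borel_closed; exact: compact_closed. Qed.

Lemma borel_cutoff (L : set X) (f : X -> R[i]) : compact L ->
  borel_complex f -> borel_complex (fun s => \1_L s * f s - f s).
Proof.
move=> cL mf; apply: borel_complexB => //; apply: borel_complexM => //.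
by apply: borel_complex_indic; exact: compact_borel.
Qed.

Lemma L2sq_cutoff_le (L : set X) (f : X -> R[i]) : compact L ->
  borel_complex f -> (L2sq mu (fun s => \1_L s * f s - f s)%R <= L2sq mu f)%E.
Proof.
move=> cL mf; apply: le_L2sq => // [|s]; first exact: borel_cutoff.
by rewrite rnorm_cutoff; case: ifP; rewrite ?rnorm_ge0.
Qed.

(** The image of a compact set under s |-> pi_(s)^* w is compact by strong
    continuity. *)
Lemma compact_orbit_net w (L : set X) (e : R) : compact L -> 0 < e ->
  exists t : seq H, forall s, L s ->
    exists2 k, k \in t & rnorm (adjoint (pi_ s) w - k) < e.
Proof.
move=> cL e0; pose K := (fun s => adjoint (pi_ s) w) @` L.
have cK : compact K.
  by apply: continuous_compact => //; apply: continuous_subspaceT; exact: pi_cont.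
have [|t tP] := @compact_net R H K e _ e0.
  by rewrite -(closure_id K).1//; apply: compact_closed => //; exact: norm_hausdorff.
by exists t => s Ls; apply: tP; exists s.
Qed.

(** The tail of a single function phi_w(x) vanishes along an exhaustion by compact
    sets.  Being uniform over the finitely many x of a net of Om, this
    extends to all of Om, since phi_w is Lipschitz and cutting off does not
    increase norms. *)
Lemma compact_K_tight Om w : bounded_set Om -> compact (closure Om) ->
  K_tight mu (phi pi_ w @` Om).
Proof.
move=> bOm cOm; split.
  split=> [_ [u _ <-]|]; first exact: L2_phi.
  have [M M0 OmM] := bounded_rnorm bOm.
  exists (M * rnorm w) => _ [u Omu <-].
  have Mw0 : 0 <= M * rnorm w by rewrite mulr_ge0 ?rnorm_ge0 ?ltW.
  rewrite L2norm_le// L2sq_phi lee_fin ler_pXn2r// ?nnegrE ?mulr_ge0 ?rnorm_ge0//.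
  by rewrite ler_wpM2r ?rnorm_ge0 ?OmM.
move=> e e0; have [K cK KT] := scX.
have w1 : 0 < rnorm w + 1 by rewrite ltr_wpDl ?rnorm_ge0.
have e20 : 0 < e / 2 by rewrite divr_gt0.
have ew : 0 < e / 2 / (rnorm w + 1) by rewrite divr_gt0.
have [t tP] := compact_net cOm ew.
have [n nt] : exists n, forall x, x \in t ->
    (L2sq mu (fun s => \1_(exhaustion K n) s * phi pi_ w x s - phi pi_ w x s)%R
      <= ((e / 2) ^+ 2)%:E)%E.
  have : \forall n \near \oo, forall x, x \in t ->
      (L2sq mu (fun s => \1_(exhaustion K n) s * phi pi_ w x s - phi pi_ w x s)%R
      <= ((e / 2) ^+ 2)%:E)%E.
    elim: {tP} t => [|x t IHt]; first by apply: nearW.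
    have ee0 : 0 < (e / 2) ^+ 2 by rewrite exprn_gt0.
    have := L2_tail hX cK KT (L2_phi w x) ee0.
    apply: filterS2 IHt => n IHn xn y; rewrite inE => /predU1P[->//|]; exact: IHn.
  by move=> [N _ /(_ N (leqnn N))]; exists N.
have cL := compact_exhaustion (n := n) cK; exists (exhaustion K n) => //.
apply/sup_over_le; first by rewrite lee_fin ltW.
move=> _ [u Omu <-]; rewrite L2norm_le; last exact: ltW.
have [x xt ux] := tP u Omu.
set L := exhaustion K n in nt cL *.
have -> : e ^+ 2 = 2 * ((e / 2) ^+ 2 + (e / 2) ^+ 2) by field.
have -> : (fun s => \1_L s * phi pi_ w u s - phi pi_ w u s) =
    (fun s => (\1_L s * phi pi_ w x s - phi pi_ w x s) +
              (\1_L s * phi pi_ w (u - x) s - phi pi_ w (u - x) s)).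
  by apply/funext => s; rewrite phiB; ring.
apply: L2sqD_le; [exact: borel_cutoff (borel_phi _ _)..|exact: nt|].
apply: le_trans (L2sq_cutoff_le cL (borel_phi _ _)) _.
rewrite L2sq_phi lee_fin ler_pXn2r ?nnegrE ?mulr_ge0 ?rnorm_ge0 ?(ltW e0)//.
move: ux; rewrite ltr_pdivlMr// => /ltW; apply: le_trans.
by rewrite ler_wpM2l ?rnorm_ge0// lerDl.
Qed.

(** By the orthogonality relation |u - v| |w| is the L^2 norm of phi_w(u - v).
    Outside L it is small for all u and v in Om, by tightness.  On L, its
    value at s is <u - v, pi_(s)^* w>, where pi_(s)^* w is close to one of
    finitely many vectors k; so it is small when <u, k> and <v, k> are close
    for all these k, and finitely many pieces of Om ensure that. *)
Lemma K_tight_compact Om w : bounded_set Om -> w != 0 ->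
  K_tight mu (phi pi_ w @` Om) -> compact (closure Om).
Proof.
move=> /bounded_rnorm[M M0 OmM] w0 [_ tight]; apply: split_compact_closure => e e0.
have w_gt0 : 0 < rnorm w by rewrite rnorm_gt0.
have ew : 0 < e * rnorm w / 4 by rewrite divr_gt0 ?mulr_gt0.
have [L cL /sup_over_le LP] := tight _ ew.
have {}LP u : Om u ->
    (L2sq mu (fun s => \1_L s * phi pi_ w u s - phi pi_ w u s)%R <=
      ((e * rnorm w / 4) ^+ 2)%:E)%E.
  move=> Omu; rewrite -L2norm_le; last exact: ltW.
  apply: LP; last by exists u.
  by rewrite lee_fin ltW.
have mL := compact_borel cL.
pose m : R := fine (mu L).
have muL : mu L = m%:E by rewrite fineK// ge0_fin_numE//; exact: finK.
have m0 : 0 <= m by rewrite fine_ge0.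
have m1 : 0 < m + 1 by rewrite ltr_wpDl.
(* The tails contribute 8 (e |w| / 4)^2 and the set L contributes 2 d^2 m to
   |u - v|^2 |w|^2, each at most e^2 |w|^2 / 2. *)
pose d := e * rnorm w / 2 / (m + 1).
have d0 : 0 < d by rewrite !divr_gt0 ?mulr_gt0.
have dM : 0 < d / 2 / (M + M).
  by apply: divr_gt0; [exact: divr_gt0|exact: addr_gt0].
have [t tP] := compact_orbit_net w cL dM.
have d20 : 0 < d / 2 by exact: divr_gt0.
have [k u kt Omu|I [c cP]] := @bounded_complex_finitely_split R _ t H Om
    (fun k u => inner u k) (M * \sum_(k <- t) rnorm k) _ d20.
  rewrite (le_trans (cauchy_schwarz _ _))// ler_pM ?rnorm_ge0 ?OmM//.
  by rewrite (big_rem k)//= lerDl sumr_ge0// => k' _; exact: rnorm_ge0.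
exists I, c => u v Omu Omv cuv.
have small s : L s -> rnorm (phi pi_ w (u - v) s) <= d.
  move=> /tP[k kt ks]; rewrite phi_adjoint.
  have -> : inner (u - v) (adjoint (pi_ s) w) =
    (inner u k - inner v k) + inner (u - v) (adjoint (pi_ s) w - k).
    by rewrite innerBr !innerBl; ring.
  rewrite (le_trans (ler_rnormD _ _))// (splitr d) lerD//; first exact: cP.
  rewrite (le_trans (cauchy_schwarz _ _))//.
  have -> : d / 2 = (M + M) * (d / 2 / (M + M)).
    by rewrite [RHS]mulrC divfK// gt_eqF// addr_gt0.
  by rewrite ler_pM ?rnorm_ge0 ?(ltW ks)// (le_trans (ler_rnormB _ _))// lerD ?OmM.
have mphi := borel_phi w (u - v).
have : (L2sq mu (phi pi_ w (u - v)%R) <=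
    (2 * (d ^+ 2 * m +
      2 * ((e * rnorm w / 4) ^+ 2 + (e * rnorm w / 4) ^+ 2)))%:E)%E.
  have -> : phi pi_ w (u - v) = (fun s => \1_L s * phi pi_ w (u - v) s +
      - (\1_L s * phi pi_ w (u - v) s - phi pi_ w (u - v) s)).
    by apply/funext => s; ring.
  apply: L2sqD_le.
  - apply: borel_complexM => //; exact: borel_complex_indic.
  - under eq_fun do rewrite -mulN1r; apply: borel_complexM.
      exact: borel_complex_cst.
    exact: borel_cutoff.
  - apply: (L2sq_bounded_support mL muL).
    + apply: borel_complexM => //; exact: borel_complex_indic.
    + by move=> s Ls; rewrite indicE mem_set// mul1r small.
    + by move=> s nLs; rewrite indicE memNset// mul0r.
  - have -> : (fun s => - (\1_L s * phi pi_ w (u - v) s - phi pi_ w (u - v) s)) =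
        (fun s => - 1%R * (\1_L s * phi pi_ w u s - phi pi_ w u s) +
                  (\1_L s * phi pi_ w v s - phi pi_ w v s)).
      by apply/funext => s; rewrite phiB; ring.
    apply: L2sqD_le; [|exact: borel_cutoff (borel_phi _ _)| |exact: LP].
      apply: borel_complexM; [exact: borel_complex_cst|].
      exact: borel_cutoff (borel_phi _ _).
    apply: le_trans (LP u Omu).
    rewrite le_eqVlt; apply/orP; left; apply/eqP.
    by apply: eq_integral => s _; rewrite mulN1r rnormN.
rewrite L2sq_phi lee_fin => le_uv.
rewrite -(ler_pM2r w_gt0) -(@ler_pXn2r _ 2)//;
  rewrite ?nnegrE ?mulr_ge0 ?rnorm_ge0 ?(ltW e0)//.
apply: le_trans le_uv _.
have : d ^+ 2 * m <= (e * rnorm w / 2) ^+ 2.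
  rewrite /d expr_div_n mulrAC ler_pdivrMr ?exprn_gt0//.
  rewrite ler_wpM2l ?sqr_ge0//; nra.
by move: (d ^+ 2 * m) (e * rnorm w) => a b; rewrite !expr_div_n; lra.
Qed.

End square_integrable_map.

(** * Tightness with respect to the symbolic calculus *)
Section orthogonal_projection.
Context {R : realType} {H : hilbertType R}.
Implicit Types (F : seq H) (x y : H).

(** The orthogonal projection onto the span of F when F is orthonormal. *)
Definition proj_on F x : H := \sum_(e <- F) inner x e *: e.

Definition orthonormal_seq F :=
  uniq F /\ forall e f, e \in F -> f \in F -> inner e f = (e == f)%:R.

Lemma proj_on_orthogonal F x e :
  orthonormal_seq F -> e \in F -> inner (x - proj_on F x) e = 0.
Proof.
move=> [uF oF] eF; rewrite innerBl /proj_on inner_suml (bigD1_seq e)//=.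
rewrite innerZl (oF e e)// eqxx mulr1 big_seq_cond big1 ?addr0 ?subrr//.
by move=> f /andP[fF fe]; rewrite innerZl (oF f e)// (negbTE fe) mulr0.
Qed.

(** The projection is the best approximation of x from the span of F, by
    Pythagoras. *)
Lemma proj_on_minimal F (t : seq (R[i] * H)) x : orthonormal_seq F ->
    (forall p, p \in t -> p.2 \in F) ->
  rnorm (x - proj_on F x) <= rnorm (x - \sum_(p <- t) p.1 *: p.2).
Proof.
move=> oF tF; set y := \sum_(p <- t) _.
have ortho : inner (x - proj_on F x) (proj_on F x - y) = 0.
  rewrite innerBr /y !inner_sumr !big_seq !big1 ?subrr//.
    by move=> p pt; rewrite innerZr proj_on_orthogonal ?mulr0// tF.
  by move=> e eF; rewrite innerZr proj_on_orthogonal ?mulr0.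
rewrite -(@ler_pXn2r _ 2)// ?nnegrE ?rnorm_ge0//.
have -> : x - y = (x - proj_on F x) + (proj_on F x - y) by rewrite addrA subrK.
by rewrite [leRHS]rnorm_sqrD ortho mulr0 addr0 lerDl sqr_ge0.
Qed.

(** Each x in s is near a finite combination of basis vectors; taking F to contain
    all the basis vectors involved, minimality of the projection transfers these
    approximations to F. *)
Lemma proj_on_approx (E : set H) (s : seq H) (e : R) :
    orthonormal_basis E -> 0 < e ->
  exists2 F, orthonormal_seq F &
    forall x, x \in s -> rnorm (x - proj_on F x) < e.
Proof.
move=> [oE ET] e0.
suff [F [FE [uF sF]]] : exists F, (forall f, f \in F -> E f) /\
    uniq F /\ forall x, x \in s -> rnorm (x - proj_on F x) < e.
  by exists F => //; split=> // f g fF gF; apply: oE; exact: FE.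
elim: s => [|x s [F [FE [uF sF]]]]; first by exists [::].
have : closure (lin_span E) x by rewrite ET.
move=> /closure_rnorm/(_ _ e0)[_ [t [tE ->]] xt].
pose G := undup ([seq p.2 | p <- t] ++ F).
have GE f : f \in G -> E f.
  rewrite mem_undup mem_cat => /orP[/mapP[p pt ->]|]; [exact: tE|exact: FE].
have oG : orthonormal_seq G.
  split; first exact: undup_uniq.
  by move=> f g fG gG; apply: oE; exact: GE.
exists G; split=> //; split=> [|y]; first exact: undup_uniq.
rewrite inE => /predU1P[->|ys].
  apply: le_lt_trans xt; apply: proj_on_minimal => // p pt.
  by rewrite mem_undup mem_cat map_f.
apply: le_lt_trans (sF y ys).
have -> : proj_on F y = \sum_(p <- [seq (inner y f, f) | f <- F]) p.1 *: p.2.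
  by rewrite big_map.
apply: proj_on_minimal => // _ /mapP[f fF ->] /=.
by rewrite mem_undup mem_cat fF orbT.
Qed.

End orthogonal_projection.

Section symbolic_calculus.
Context {R : realType} {H : hilbertType R} {X : ptopologicalType}.
Variables (mu : {measure set (borel X) -> \bar R}) (pi_ : X -> H -> H).
Variables (T : hilbertTensor H (conj_space H)).
Variables (Phi : T -> X -> R[i]) (Lambda : T -> H -> H).
Hypothesis HPhi : is_Phi mu pi_ Phi.
Hypothesis HLambda : is_Lambda Lambda.
Hypothesis surPhi : L2_surjective mu Phi.

Local Notation Pi := (Pi_calculus mu Phi Lambda).

Lemma borel_Phi psi : borel_complex (Phi psi).
Proof. by have [/(_ psi)/L2P[]] := HPhi. Qed.

Lemma L2sq_Phi psi : L2sq mu (Phi psi) = (rnorm psi ^+ 2)%:E.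
Proof. by apply: L2sq_eq; have [] := HPhi. Qed.

Lemma ae_PhiB psi chi :
  ae_equal mu (Phi (psi - chi)) (fun s => Phi psi s - Phi chi s).
Proof.
have [_ /(_ (-1) chi psi) Phi_lin _ _] := HPhi.
rewrite scaleN1r addrC in Phi_lin.
by apply: filterS Phi_lin => s /= ->; rewrite mulN1r addrC.
Qed.

(** [Phi] is additive only almost everywhere, so finite sums need their own
    induction. *)
Lemma ae_Phi_sum (s : seq (R[i] * (H * H))) :
  ae_equal mu (Phi (\sum_(p <- s) p.1 *: tens T p.2.1 p.2.2))
    (fun t => \sum_(p <- s) p.1 * inner (pi_ t p.2.1) p.2.2).
Proof.
have [_ Phi_lin _ Phi_tens] := HPhi.
elim: s => [|p s IHs].
  have := ae_PhiB 0 0; rewrite subrr; apply: filterS => t /= Phi0.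
  by rewrite !big_nil Phi0 subrr.
have := Phi_lin p.1 (tens T p.2.1 p.2.2)
  (\sum_(p <- s) p.1 *: tens T p.2.1 p.2.2).
move: IHs (Phi_tens p.2.1 p.2.2); apply: filterS3 => t /= sE pE.
by rewrite !big_cons => ->; rewrite sE pE.
Qed.

Lemma rnorm_Phi_dist (psi chi : T) (f g : X -> R[i]) (e : R) : 0 <= e ->
    borel_complex f -> borel_complex g ->
    ae_equal mu (Phi psi) f -> ae_equal mu (Phi chi) g ->
    (L2sq mu (fun s => f s - g s)%R <= (e ^+ 2)%:E)%E ->
  rnorm (psi - chi) <= e.
Proof.
move=> e0 mf mg psif chig fge.
rewrite -(@ler_pXn2r _ 2)// ?nnegrE ?rnorm_ge0// -lee_fin -L2sq_Phi.
apply: le_trans fge; rewrite le_eqVlt; apply/orP; left; apply/eqP.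
apply: ae_L2sq; [exact: borel_Phi|exact: borel_complexB|].
by move: psif chig (ae_PhiB psi chi); apply: filterS3 => s /= -> ->.
Qed.

(** Whatever preimage of f is chosen, it maps to f almost everywhere; this is all
    that the estimates on [Pi f] use. *)
Lemma Pi_Phi (f : X -> R[i]) : L2 mu f ->
  exists2 chi, ae_equal mu (Phi chi) f & Pi f = Lambda chi.
Proof.
move=> /surPhi[chi0 chi0f]; exists (xget 0 [set psi | ae_equal mu (Phi psi) f]) => //.
by case: xgetP => [chi _ //|/(_ chi0)].
Qed.

(** The projection onto the span of F is [Lambda] of the sum of the tensors
    v (x) v for v in F, and [Phi] sends that sum to the function
    s |-> sum of <pi_(s) v, v>. *)
Lemma Pi_proj_on_approx (F : seq H) (f : X -> R[i]) (e : R) : 0 <= e ->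
    (forall u v, borel_complex (phi pi_ v u)) -> L2 mu f ->
    (L2sq mu (fun s => f s - \sum_(v <- F) inner (pi_ s v) v)%R <= (e ^+ 2)%:E)%E ->
  forall u, rnorm (Pi f u - proj_on F u) <= e * rnorm u.
Proof.
move=> e0 mphi L2f fe u; have [chi chif ->] := Pi_Phi L2f.
pose s := [seq (1 : R[i], (v, v)) | v <- F].
pose psi := \sum_(p <- s) p.1 *: tens T p.2.1 p.2.2.
have -> : proj_on F u = Lambda psi u.
  rewrite (Lambda_sum HLambda) big_map; apply: eq_bigr => v _ /=.
  by rewrite mul1r.
rewrite -(LambdaB HLambda) (le_trans (Lambda_le HLambda _ _))//.
rewrite ler_wpM2r ?rnorm_ge0//.
apply: (rnorm_Phi_dist e0 _ _ chif (ae_Phi_sum s)).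
- by move/L2P : L2f => [].
- rewrite /s {fe psi s}; elim: F => [|v F IHF].
    by under eq_fun do rewrite big_nil; exact: borel_complex_cst.
  under eq_fun do rewrite big_cons mul1r; apply: borel_complexD => //.
  exact: mphi.
- apply: le_trans fe; rewrite le_eqVlt; apply/orP; left; apply/eqP.
  apply: eq_integral => t _; rewrite big_map.
  by under eq_bigr do rewrite mul1r.
Qed.

(** Up to e / 3, a vector u of Om is its image under the compact operator
    [Pi f]. *)
Lemma Pi_tight_compact (Om : set H) : bounded_set Om ->
    (forall eps : R, 0 < eps -> exists2 f : X -> R[i], Cc f &
      (sup_over Om (fun u => (rnorm (Pi f u - u)%R)%:E) <= eps%:E)%E) ->
  compact (closure Om).
Proof.
move=> bOm tight; apply: split_compact_closure => e e0.
have e30 : 0 < e / 3 by rewrite divr_gt0.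
have [f _ /sup_over_le fe] := tight _ e30.
have [I [c cP]] := Lambda_finitely_split HLambda
  (xget 0 [set psi | ae_equal mu (Phi psi) f]) bOm e30.
exists I, c => u v Omu Omv cuv.
have := cP u v Omu Omv cuv; rewrite -/(Pi f).
have : rnorm (Pi f u - u) <= e / 3.
  by rewrite -lee_fin; apply: fe => //; rewrite lee_fin ltW.
have : rnorm (Pi f v - v) <= e / 3.
  by rewrite -lee_fin; apply: fe => //; rewrite lee_fin ltW.
have := ler_rdistD (Pi f u) u v; have := ler_rdistD (Pi f v) (Pi f u) v.
rewrite (rnorm_distC u (Pi f u)); lra.
Qed.

Hypothesis hX : hausdorff_space X.
Hypothesis lcX : locally_compact [set: X].
Hypothesis scX : sigma_compact X.
Hypothesis pi_bounded : forall s, bounded_operator (pi_ s).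
Hypothesis pi_cont : forall u : H,
  continuous (fun s : X => adjoint (pi_ s) u).

(** The projection onto the span of a finite part F of an orthonormal basis nearly
    fixes Om.  Its symbol G is continuous, being a finite sum of functions
    <pi_(s) v, v>, but need not have compact support; multiplying G by a bump
    function that is 1 on a large compact set changes it little in L^2. *)
Lemma compact_Pi_tight (Om : set H) : bounded_set Om -> compact (closure Om) ->
  forall eps : R, 0 < eps -> exists2 f : X -> R[i], Cc f &
    (sup_over Om (fun u => (rnorm (Pi f u - u)%R)%:E) <= eps%:E)%E.
Proof.
move=> bOm cOm e e0; have [M M0 OmM] := bounded_rnorm bOm.
have e40 : 0 < e / 4 by rewrite divr_gt0.
have [s sP] := compact_net cOm e40.
have [E onE] := exists_orthonormal_basis HLambda.
have [F oF FP] := proj_on_approx s onE e40.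
have FOm u : Om u -> rnorm (u - proj_on F u) <= e / 2.
  move=> /sP[x xs ux].
  have -> : e / 2 = e / 4 + e / 4 by field.
  have := proj_on_minimal (t := [seq (inner x f, f) | f <- F]) u oF.
  rewrite big_map -/(proj_on F x) => /(_ _)/le_trans; apply.
    by move=> _ /mapP[f fF ->].
  rewrite (le_trans (ler_rdistD x _ _))// lerD// ltW//; exact: FP.
pose G (t : X) := \sum_(v <- F) inner (pi_ t v) v.
have cG : continuous (G : X -> R[i]^o).
  rewrite /G; elim: F {oF FP FOm G} => [|v F IHF].
    by under eq_fun do rewrite big_nil; move=> t; exact: cvg_cst.
  under eq_fun do rewrite big_cons.
  move=> t; have cv := @continuous_phi R H X pi_ pi_bounded pi_cont v v.
  exact: (cvgD (cv t) (IHF t)).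
have mG := continuous_borel_complex cG.
have L2G : L2 mu G.
  apply/L2P; split=> //.
  have := ae_Phi_sum [seq (1 : R[i], (v, v)) | v <- F].
  set psi := \sum_(p <- _) _ => psiG.
  have <- : L2sq mu (Phi psi) = L2sq mu G; last by rewrite L2sq_Phi ltry.
  apply: ae_L2sq => //; first exact: borel_Phi.
  apply: filterS psiG => t /= ->; rewrite big_map.
  by under eq_bigr do rewrite mul1r.
have eM : 0 < e / 2 / M by rewrite !divr_gt0.
have eM2 : 0 < (e / 2 / M) ^+ 2 by rewrite exprn_gt0.
have [K cK KT] := scX.
have [N _ /(_ N (leqnn N)) tailN] := L2_tail hX cK KT L2G eM2.
have cL := compact_exhaustion (n := N) cK.
set L := exhaustion K N in tailN cL.
have [k [C [bk kL]]] := @bump_compact R X hX lcX L cL.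
pose f t := (k t)%:C%C * G t.
have Ccf : Cc f := Cc_bump hX bk cG.
have mf : borel_complex f by apply: continuous_borel_complex; exact: Ccf.1.
have kI t : 0 <= k t <= 1 by have [] := bk.
exists f => //; apply/sup_over_le; first by rewrite lee_fin ltW.
move=> u Omu; rewrite lee_fin.
rewrite (le_trans (ler_rdistD (proj_on F u) _ _))// (splitr e) lerD//; last first.
  by rewrite rnorm_distC FOm.
have -> : e / 2 = e / 2 / M * M by rewrite divfK// gt_eqF.
apply: (@le_trans _ _ (e / 2 / M * rnorm u)); last first.
  by rewrite ler_wpM2l ?(ltW eM)// OmM.
apply: Pi_proj_on_approx; first exact: ltW.
- by move=> x y; exact: borel_phi.
- apply/L2P; split=> //; apply: le_lt_trans (_ : L2sq mu G < +oo)%E.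
    apply: le_L2sq => // t; rewrite /f rnormM rnorm_real.
    have /andP[k0 k1] := kI t.
    by rewrite ger0_norm// -[leRHS]mul1r ler_wpM2r ?rnorm_ge0.
  by move/L2P : L2G => [].
- apply: le_trans tailN; apply: le_L2sq; first exact: borel_complexB.
    exact: borel_cutoff.
  move=> t; rewrite rnorm_cutoff; case: ifPn => [/set_mem Lt|_].
    by rewrite /f kL// mul1r subrr rnorm0.
  have -> : f t - G t = (k t - 1)%:C%C * G t.
    by rewrite /f real_complexD mulrDl rmorphN mulN1r.
  rewrite rnormM rnorm_real -[leRHS]mul1r ler_wpM2r ?rnorm_ge0//.
  by have /andP[k0 k1] := kI t; rewrite ler_norml; apply/andP; split; lra.
Qed.

End symbolic_calculus.

(** * Equicontinuity and averaging *)
Section equicontinuity.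
Context {R : realType} {H : hilbertType R} {X : ptopologicalType}.
Variable pi_ : X -> H -> H.
Hypothesis lcX : locally_compact [set: X].
Hypothesis pi_bounded : forall s, bounded_operator (pi_ s).
Hypothesis pi_cont : forall u : H,
  continuous (fun s : X => adjoint (pi_ s) u).

(** On a compact neighbourhood of s0 the orbits s |-> pi_(s)^* u are bounded, as
    continuous images of a compact set, and uniform boundedness applies. *)
Lemma locally_bounded_adjoint (s0 : X) : exists2 M : R, 0 < M &
  \forall s \near s0, forall u, rnorm (adjoint (pi_ s) u) <= M * rnorm u.
Proof.
have [C s0C [cC _]] : compact_near (nbhs s0).
  by have := @lcX s0 I; rewrite withinET.
have [s _|s _|u|M M0 CM] := @uniform_boundedness R H H X C
    (fun s => adjoint (pi_ s)).
- exact: adjoint_linear.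
- exact: adjoint_bounded.
- have [t tP] := compact_orbit_net pi_cont u cC ltr01.
  exists (\sum_(k <- t) rnorm k + 1) => s /tP[k kt sk].
  have := ler_rnormD (adjoint (pi_ s) u - k) k; rewrite subrK.
  have : rnorm k <= \sum_(k <- t) rnorm k.
    by rewrite (big_rem k)//= lerDl sumr_ge0// => k' _; exact: rnorm_ge0.
  by lra.
- by exists M => //; apply: filterS s0C => s Cs u; exact: CM.
Qed.

(** Pointwise convergence on a finite net of Om is uniform convergence on Om,
    because the operators pi_(s)^* are uniformly bounded near s0. *)
Lemma compact_equicontinuous (Om : set H) : compact (closure Om) ->
  forall s0 : X, sup_over Om (fun u =>
      (rnorm (adjoint (pi_ s) u - adjoint (pi_ s0) u))%:E)
      @[s --> s0] --> (0%E : \bar R).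
Proof.
move=> cOm s0; have [M M0 near_M] := locally_bounded_adjoint s0.
have small (e : R) : 0 < e -> \forall s \near s0, (sup_over Om (fun u =>
      (rnorm (adjoint (pi_ s) u - adjoint (pi_ s0) u))%:E) <= e%:E)%E.
  move=> e0; have e30 : 0 < e / 3 by rewrite divr_gt0.
  have eM : 0 < e / 3 / M by rewrite divr_gt0.
  have [t tP] := compact_net cOm eM.
  have near_t : \forall s \near s0, forall x, x \in t ->
      rnorm (adjoint (pi_ s0) x - adjoint (pi_ s) x) < e / 3.
    elim: {tP} t => [|x t IHt]; first by apply: nearW.
    have /continuous_rnormP/(_ s0 _ e30) := @pi_cont x.
    by apply: filterS2 IHt => s IHs xs y; rewrite inE => /predU1P[->//|]; exact: IHs.
  have s0M := nbhs_singleton near_M.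
  apply: filterS2 near_M near_t => s sM st.
  apply/sup_over_le; first by rewrite lee_fin ltW.
  move=> u /tP[x xt ux]; rewrite lee_fin.
  have := ler_rdistD (adjoint (pi_ s) x) (adjoint (pi_ s) u) (adjoint (pi_ s0) u).
  have := ler_rdistD (adjoint (pi_ s0) x) (adjoint (pi_ s) x) (adjoint (pi_ s0) u).
  have := sM (u - x); rewrite (linear_funB (adjoint_linear (pi_bounded s))).
  have := s0M (x - u); rewrite (linear_funB (adjoint_linear (pi_bounded s0))).
  have := st x xt; rewrite (rnorm_distC (adjoint (pi_ s0) x) (adjoint (pi_ s) x)).
  have : M * rnorm (u - x) <= e / 3 by rewrite mulrC -ler_pdivlMr// ltW.
  by rewrite (rnorm_distC x u); lra.
apply/fine_cvgP; split.
  apply: filterS (small 1 ltr01) => s s1.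
  by rewrite ge0_fin_numE ?sup_over_ge0// (le_lt_trans s1)// ltry.
apply/cvgrPdist_le => e e0; apply: filterS (small e e0) => s se.
rewrite sub0r normrN /= ger0_norm ?fine_ge0 ?sup_over_ge0//.
rewrite -lee_fin fineK// ge0_fin_numE ?sup_over_ge0//.
by rewrite (le_lt_trans se)// ltry.
Qed.

End equicontinuity.

Section averaging.
Context {R : realType} {H : hilbertType R} {X : ptopologicalType}.
Variables (mu : {measure set (borel X) -> \bar R}) (pi_ : X -> H -> H).
Variables (T : hilbertTensor H (conj_space H)).
Variables (Phi : T -> X -> R[i]) (Lambda : T -> H -> H).
Hypothesis hX : hausdorff_space X.
Hypothesis lcX : locally_compact [set: X].
Hypothesis finK : forall K : set X, compact K -> (mu K < +oo)%E.
Hypothesis full : full_support mu.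
Hypothesis pi_bounded : forall s, bounded_operator (pi_ s).
Hypothesis pi_cont : forall u : H,
  continuous (fun s : X => adjoint (pi_ s) u).
Hypothesis HPhi : is_Phi mu pi_ Phi.
Hypothesis HLambda : is_Lambda Lambda.
Hypothesis surPhi : L2_surjective mu Phi.

Local Notation Pi := (Pi_calculus mu Phi Lambda).

Lemma bump_integrable (k : X -> R) (C : set X) : bump k C ->
  mu.-integrable setT (fun s : borel X => (k s)%:E).
Proof.
move=> [ck k01 cC k0].
have mC := compact_borel hX cC.
apply: (@le_integrable _ _ _ mu setT measurableT _ (fun s => (\1_C s)%:E)).
- by apply/measurable_EFinP; exact: continuous_borel.
- move=> s _; rewrite !abse_EFin lee_fin indicE.
  have /andP[ks0 ks1] := k01 s.
  case: (boolP (s \in C)) => [_|/negP nC]; first by rewrite ger0_norm// normr1.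
  by rewrite k0 ?normr0//; apply: contra_not nC => /mem_set.
- apply/integrableP; split; first by apply/measurable_EFinP; exact: measurable_indic.
  under eq_integral do rewrite gee0_abs ?lee_fin//.
  by rewrite integral_indic// setIT; exact: finK.
Qed.

(** A bump function at s0 supported in U, divided by its integral: full support
    makes this integral positive, and finiteness of mu on compact sets makes it
    finite. *)
Lemma approximate_identity (s0 : X) (U : set X) : open U -> U s0 ->
  exists g : X -> R,
    [/\ Cc (fun s => (g s)%:C%C : R[i]), L2 mu (fun s => (g s)%:C%C),
        forall s, 0 <= g s & forall s, ~ U s -> g s = 0] /\
    mu.-integrable setT (fun s : borel X => (g s)%:E) /\
    (\int[mu]_s (g s)%:E = 1)%E.
Proof.
move=> oU Us0; have [k [C [bk k1 kU]]] := @bump_point R X hX lcX s0 U oU Us0.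
have [ck k01 cC k0] := bk.
have ik := bump_integrable bk.
pose V := [set s | 2^-1 < k s].
have oV : open V.
  by apply: (@open_comp _ _ k [set y | 2^-1 < y]) => // s _; exact: ck.
have mV : measurable (V : set (borel X)) by exact: borel_open.
have muV : (0 < mu V)%E.
  by apply: full => //; exists s0; rewrite /V/= k1 invf_lt1// ltr1n.
have int_gt0 : (0 < \int[mu]_s (k s)%:E)%E.
  apply: (@lt_le_trans _ _ (2^-1%:E * mu V)%E); first by rewrite mule_gt0.
  rewrite -integral_cst// [leLHS]integral_mkcond.
  apply: ge0_le_integral => //.
  - by move=> s _; rewrite patchE; case: ifP => // _; rewrite lee_fin invr_ge0.
  - by apply/(measurable_restrictT _ _).1 => //; exact: measurable_cst.
  - by case/integrableP : ik.
  - move=> s _; rewrite patchE; case: ifPn => [/set_mem/ltW//|_].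
    by have /andP[] := k01 s.
have fin_int : (\int[mu]_s (k s)%:E)%E \is a fin_num by exact: integrable_fin_num.
pose a : R := fine (\int[mu]_s (k s)%:E)%E.
have a0 : 0 < a by rewrite -lte_fin fineK.
have ca : continuous ((fun=> (a^-1)%:C%C) : X -> R[i]^o) by move=> s; exact: cvg_cst.
have gE : (fun s => (a^-1 * k s)%:C%C : R[i]) =
    (fun s => (k s)%:C%C * (a^-1)%:C%C).
  by apply/funext => s; rewrite -real_complexM mulrC.
have Cg := Cc_bump hX bk ca.
exists (fun s => a^-1 * k s); split; [split|split].
- by rewrite gE.
- have mg : borel_complex (fun s => (a^-1 * k s)%:C%C).
    by rewrite gE; apply: continuous_borel_complex; exact: Cg.1.
  have mC := compact_borel hX cC.
  have muC : mu C = (fine (mu C))%:E by rewrite fineK// ge0_fin_numE//; exact: finK.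
  apply/L2P; split=> //.
  have gC := @L2sq_bounded_support R X mu _ C a^-1 _ mC muC mg.
  apply: le_lt_trans (gC _ _) (ltry _) => s Cs; last by rewrite k0 ?mulr0.
  have /andP[ks0 ks1] := k01 s.
  rewrite rnorm_real ger0_norm ?mulr_ge0 ?invr_ge0 ?(ltW a0)//.
  by rewrite ler_piMr// invr_ge0 ltW.
- by move=> s; rewrite mulr_ge0 ?invr_ge0 ?(ltW a0)//; have /andP[] := k01 s.
- by move=> s nU; rewrite kU ?mulr0.
- by under eq_fun do rewrite EFinM; exact: integrableZl.
- under eq_integral do rewrite EFinM; rewrite integralZl//.
  by rewrite -[X in (_ * X)%E]fineK// -EFinM mulVf// gt_eqF.
Qed.

Lemma L2sq_integrable (f : X -> R[i]) (x : R) : borel_complex f ->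
    L2sq mu f = x%:E ->
  mu.-integrable setT (fun s : borel X => (rnorm (f s) ^+ 2)%:E).
Proof.
move=> mf fx; apply/integrableP; split; first exact: borel_rnorm2.
under eq_integral do rewrite gee0_abs ?lee_fin ?sqr_ge0//.
by rewrite -/(L2sq mu f) fx ltry.
Qed.

(** The weak form of Pi g as the integral of g(s) pi_(s)^*, in its real
    part and for real g.  With chi a preimage of g under [Phi] and
    psi = y (x) u, the left-hand side is the integral of g Re h, where h is
    s |-> <pi_(s) y, u> = Phi psi.  The integrand is polarised into squared
    moduli of g, h and g - h, whose integrals are |chi|^2, |psi|^2 and
    |chi - psi|^2 since [Phi] is isometric; this also gives integrability. *)
Lemma Pi_weak (g : X -> R) (u y : H) : L2 mu (fun s => (g s)%:C%C) ->
  mu.-integrable setT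
    (fun s : borel X => (g s * Re (inner (adjoint (pi_ s) u) y))%:E) /\
  (\int[mu]_s (g s * Re (inner (adjoint (pi_ s) u) y))%:E =
    (Re (inner (Pi (fun s => (g s)%:C%C) u) y))%:E)%E.
Proof.
move=> L2g; have [chi chig ->] := Pi_Phi Lambda surPhi L2g.
have /L2P[mg _] := L2g.
pose h := phi pi_ u y; pose psi := tens T y u.
have mh : borel_complex h by exact: borel_phi.
have psih : ae_equal mu (Phi psi) h by have [_ _ _] := HPhi; apply.
have ig : L2sq mu (fun s => (g s)%:C%C) = (rnorm chi ^+ 2)%:E.
  by rewrite -(L2sq_Phi HPhi); apply/esym/ae_L2sq => //; exact: borel_Phi HPhi _.
have ih : L2sq mu h = (rnorm psi ^+ 2)%:E.
  by rewrite -(L2sq_Phi HPhi); apply/esym/ae_L2sq => //; exact: borel_Phi HPhi _.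
have mgh := borel_complexB mg mh.
have igh : L2sq mu (fun s => (g s)%:C%C - h s) = (rnorm (chi - psi) ^+ 2)%:E.
  rewrite -(L2sq_Phi HPhi); apply/esym/ae_L2sq => //; first exact: borel_Phi HPhi _.
  by move: chig psih (ae_PhiB HPhi chi psi); apply: filterS3 => s /= -> ->.
have polar s : g s * Re (inner (adjoint (pi_ s) u) y) =
    2^-1 * (rnorm ((g s)%:C%C : R[i]) ^+ 2 + rnorm (h s) ^+ 2 -
            rnorm ((g s)%:C%C - h s) ^+ 2).
  rewrite Re_innerC -adjointP// -/(phi pi_ u y s) -/(h s).
  rewrite !rnorm_sqr cReD cImD cReN cImN /=.
  by move: (Re (h s)) (Im (h s)) => p q; field.
have jg := L2sq_integrable mg ig; have jh := L2sq_integrable mh ih.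
have jgh := L2sq_integrable mgh igh.
have -> : (fun s : borel X => (g s * Re (inner (adjoint (pi_ s) u) y))%:E) =
    (fun s => 2^-1%:E * ((rnorm ((g s)%:C%C : R[i]) ^+ 2)%:E +
      (rnorm (h s) ^+ 2)%:E - (rnorm ((g s)%:C%C - h s)%R ^+ 2)%:E))%E.
  by apply/funext => s; rewrite polar EFinM EFinB EFinD.
have jD := integrableD measurableT jg jh.
have jB := integrableB measurableT jD jgh.
split; first exact: integrableZl jB.
rewrite (integralZl measurableT jB).
rewrite (integralB measurableT jD jgh) (integralD measurableT jg jh).
rewrite -/(L2sq mu h) -/(L2sq mu (fun s => (g s)%:C%C)).
rewrite -/(L2sq mu (fun s => (g s)%:C%C - h s)%R) ig ih igh.
rewrite -EFinB -EFinM (Lambda_inner HLambda) rnorm_sqrB; congr (_%:E).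
by rewrite -/psi; field.
Qed.

(** Let g >= 0 have integral 1 and vanish where pi_(s)^* u is not within eps of
    pi_(s0)^* u for all u in Om.  Then Pi g u is an average of vectors close to
    pi_(s0)^* u.  Norms are recovered from the weak formula by testing against
    the error y itself. *)
Lemma equicontinuous_Pi_approx (Om : set H) (s0 : X) :
    sup_over Om (fun u => (rnorm (adjoint (pi_ s) u - adjoint (pi_ s0) u))%:E)
      @[s --> s0] --> (0%E : \bar R) ->
  forall eps : R, 0 < eps -> exists2 g : X -> R[i], Cc g &
    (sup_over Om (fun u => (rnorm (Pi g u - adjoint (pi_ s0) u)%R)%:E)
      <= eps%:E)%E.
Proof.
move=> /fine_cvgP[fin_sup /cvgrPdist_le near_sup] e e0.
have : nbhs s0 [set s | forall u, Om u ->
    rnorm (adjoint (pi_ s) u - adjoint (pi_ s0) u) <= e].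
  apply: filterS2 fin_sup (near_sup _ e0) => s fs; rewrite /= sub0r normrN.
  move=> /(le_trans (ler_norm _)) se u Omu.
  have /sup_over_le : (sup_over Om (fun u =>
      (rnorm (adjoint (pi_ s) u - adjoint (pi_ s0) u))%:E) <= e%:E)%E.
    by rewrite -(fineK fs) lee_fin.
  by rewrite -lee_fin; apply => //; rewrite lee_fin ltW.
rewrite nbhsE => -[U [oU Us0] Ue].
have [g [[Cg L2g g0 gU] [ig int1]]] := approximate_identity oU Us0.
exists (fun s => (g s)%:C%C) => //; apply/sup_over_le; first by rewrite lee_fin ltW.
move=> u Omu; rewrite lee_fin.
set y := _ - _.
have [->|y0] := eqVneq y 0; first by rewrite rnorm0 ltW.
have [iy inty] := Pi_weak u y L2g.
have y_gt0 : 0 < rnorm y by rewrite rnorm_gt0.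
rewrite -(ler_pM2r y_gt0) -expr2 -Re_innerxx {1}/y innerBl cReD cReN lerBlDr.
rewrite -lee_fin -inty.
set b := e * rnorm y + _.
have -> : b%:E = (\int[mu]_s (b%:E * (g s)%:E))%E.
  by rewrite integralZl// int1 mule1.
apply: le_integral => //; first exact: integrableZl.
move=> s _; rewrite -EFinM lee_fin mulrC.
have [Us|nUs] := pselect (U s); last by rewrite gU// !mulr0.
rewrite ler_wpM2r// -lerBlDr -cReN -cReD -innerBl.
rewrite (le_trans (Re_inner_le _ _))// ler_wpM2r ?rnorm_ge0//.
exact: Ue.
Qed.

End averaging.

(** * The equivalences *)

Theorem theorem4p1 (R : realType) (H : hilbertType R) (Sigma : ptopologicalType)
  (mu : {measure set (borel Sigma) -> \bar R}) (pi_ : Sigma -> H -> H)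
  (T : hilbertTensor H (conj_space H)) (Phi : T -> Sigma -> R[i])
  (Lambda : T -> H -> H) (Omega : set H)
  (H_nonzero : exists w : H, w != 0)
  (H_separable : separable H)
  (Sigma_hausdorff : hausdorff_space Sigma)
  (Sigma_locally_compact : locally_compact [set: Sigma])
  (Sigma_sigma_compact : sigma_compact Sigma)
  (mu_radon : radon mu)
  (pi_bounded : forall s, bounded_operator (pi_ s))
  (pi_square_integrable : forall u v : H,
    (\int[mu]_s (rnorm (inner (pi_ s u) v) ^+ 2)%:E
       = (rnorm u ^+ 2 * rnorm v ^+ 2)%:E)%E)
  (pi_adjoint_continuous : forall u : H,
    continuous (fun s : Sigma => adjoint (pi_ s) u))
  (Phi_spec : is_Phi mu pi_ Phi)
  (Phi_surjective : L2_surjective mu Phi)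
  (Lambda_spec : is_Lambda Lambda)
  (Omega_bounded : bounded_set Omega) :
  let Pi := Pi_calculus mu Phi Lambda in
  let A1 := compact (closure Omega) in
  let A2 := forall w : H, K_tight mu (phi pi_ w @` Omega) in
  let A3 := exists2 w0 : H, w0 != 0 & K_tight mu (phi pi_ w0 @` Omega) in
  let A4 := forall eps : R, 0 < eps -> exists2 f : Sigma -> R[i], Cc f &
    (sup_over Omega (fun u => (rnorm (Pi f u - u)%R)%:E) <= eps%:E)%E in
  let A5 := forall s0 : Sigma,
    sup_over Omega (fun u =>
      (rnorm (adjoint (pi_ s) u - adjoint (pi_ s0) u))%:E)
      @[s --> s0] --> (0%E : \bar R) in
  let A6 := forall (eps : R) (s0 : Sigma), 0 < eps -> exists2 g : Sigma -> R[i], Cc g &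
    (sup_over Omega (fun u => (rnorm (Pi g u - adjoint (pi_ s0) u)%R)%:E)
      <= eps%:E)%E in
  [/\ [<-> A1; A2; A3; A4],
      A1 -> A5,
      full_support mu -> A5 -> A6 &
      full_support mu -> (exists s1, forall u, adjoint (pi_ s1) u = u) ->
        [<-> A1; A2; A3; A4; A5; A6]].
Proof.
move=> Pi A1 A2 A3 A4 A5 A6.
have finK : forall K : set Sigma, compact K -> (mu K < +oo)%E by case: mu_radon.
have A12 : A1 -> A2.
  by move=> cOm w; apply: compact_K_tight.
have A23 : A2 -> A3.
  by have [w w0] := H_nonzero; move=> a2; exists w => //; exact: a2.
have A31 : A3 -> A1.
  by move=> [w w0 tw]; apply: (K_tight_compact _ _ _ _ _ _ w0 tw).
have A14 : A1 -> A4.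
  by move=> cOm; exact: (compact_Pi_tight Phi_spec Lambda_spec Phi_surjective).
have A41 : A4 -> A1 by exact: (Pi_tight_compact Lambda_spec Omega_bounded).
have A15 : A1 -> A5 by move=> cOm; exact: compact_equicontinuous.
have A56 : full_support mu -> A5 -> A6.
  by move=> full a5 e s0 e0; exact: equicontinuous_Pi_approx.
split=> //.
  by split=> //; split=> //; split=> // /A31/A14.
move=> full [s1 pi1].
split=> //; split=> //; split; first by move=> /A31/A14.
split; first by move=> /A41/A15.
split; first exact: A56.
move=> a6; apply: A41 => e e0; have [g Cg ge] := a6 e s1 e0; exists g => //.
rewrite (_ : (fun u => _) = (fun u => (rnorm (Pi g u - adjoint (pi_ s1) u)%R)%:E))//.
by apply/funext => u; rewrite pi1.
Qed.
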